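(* Let $H\subset\mathcal{A}^{\mathbb{Z}}$ be a one-dimensional nearest-neighbor subshift of finite type over a finite alphabet $\mathcal{A}$ whose Rauzy graph $\mathcal{G}(H)$ does not satisfy condition D. Then for any two-dimensional subshift of finite type $Y\subset\mathcal{B}^{\mathbb{Z}^2}$ over a finite alphabet $\mathcal{B}$, there exists a one-dimensional subshift of finite type $V_Y\subset\mathcal{A}^{\mathbb{Z}}$ such that $X_{H,V_Y}$ is an $(m,n)$th root of $Y$ for some positive integers $m,n$. Furthermore, $m$, $n$ and $V_Y$ can be computed algorithmically (from descriptions of $H$ and $Y$ by finite sets of forbidden patterns).
   Context: For one-dimensional subshifts of finite type (SFTs) $H,V\subset\mathcal{A}^{\mathbb{Z}}$, the combined subshift is $$X_{H,V} := \{ x \in \mathcal{A}^{\mathbb{Z}^2} \mid \forall i, j \in \mathbb{Z},\ (x_{k,j})_{k \in \mathbb{Z}} \in H \text{ and } (x_{i,\ell})_{\ell \in \mathbb{Z}} \in V \}.$$ $H$ is nearest-neighbor if it is defined by a set of forbidden words of length $2$. Its Rauzy graph $\mathcal{G}(H)=(\mathcal{V},\vec{E})$ is the directed graph whose vertices are the letters appearing in configurations of $H$, with $(a,b)\in\vec{E}$ iff the word $ab$ appears in some configuration of $H$. The strongly connected components (SCCs) are the maximal sets of mutually reachable vertices; transient vertices (those with no nontrivial path to themselves) do not form SCCs. Condition D: the graph satisfies condition D if all its SCCs have a type in common among the following three (an SCC may have none, one or several types): - $S$ is of reflexive type if $(v,v)\in\vec{E}$ for all $v\in S$; - $S$ is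 of symmetric type if for all $v\neq w\in S$ with $(v,w)\in\vec{E}$ one has $(w,v)\in\vec{E}$; - $S$ is of state-split cycle type if there are $p\geq 1$ and a partition $S=\bigsqcup_{i=0}^{p-1}V_i$ such that for all $i$, all $v\in V_i$ and all $w\in S$: $(v,w)\in\vec{E}\Leftrightarrow w\in V_{i+1 \bmod p}$. Root: let $\sigma^{\vec v}(x)_{\vec k}=x_{\vec k-\vec v}$ be the shift. A subshift $X\subset\mathcal{A}^{\mathbb{Z}^2}$ is an $(m,n)$th root of a subshift $Y\subset\mathcal{B}^{\mathbb{Z}^2}$ if there exist a clopen set $Z\subset X$ with $\sigma^{(m,0)}(Z)=Z$ and $\sigma^{(0,n)}(Z)=Z$, and a homeomorphism $\varphi\colon Z\to Y$, such that $\varphi(\sigma^{(k_1m,k_2n)}(x))=\sigma^{(k_1,k_2)}(\varphi(x))$ for all $x\in Z$, $(k_1,k_2)\in\mathbb{Z}^2$, and $X = \bigsqcup_{0 \leq i < m,\, 0 \leq j < n} \sigma^{(i,j)}(Z)$ (disjoint union). *)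

(* Defs.v *)
From HB Require Import structures.
From mathcomp Require Import all_boot all_order all_algebra.
From mathcomp Require Import all_classical.
From mathcomp Require Import topology_structure discrete_topology.
From mathcomp Require Import initial_topology product_topology.
From mathcomp Require Import function_spaces subtype_topology.
From Stdlib Require Import Relation_Operators.

Set Implicit Arguments.
Unset Strict Implicit.
Unset Printing Implicit Defensive.

Import GRing.Theory.
Local Open Scope classical_set_scope.
Local Open Scope ring_scope.

(* {ptws _ -> _} carries the product topology, here of discrete factors. *)
Definition config1 (A : finType) : Type := int -> A.
Notation config2 A := {ptws (int * int) -> (discrete_topology A)}.

(** Subshifts of finite type *)

Definition word_at (A : finType) (x : config1 A) (i : int) (w : seq A) : Prop :=
  mkseq (fun k => x (i + k%:Z)) (size w) = w.

Definition sft1 (A : finType) (F : seq (seq A)) : set (config1 A) :=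
  [set x | forall w, w \in F -> forall i, ~ word_at x i w].

Definition is_sft1 (A : finType) (H : set (config1 A)) : Prop :=
  exists F : seq (seq A), H = sft1 F.

Definition forbids_pairs (A : finType) (F : seq (seq A)) : bool :=
  all (fun w => size w == 2%N) F.

Definition nearest_neighbor (A : finType) (H : set (config1 A)) : Prop :=
  exists2 F : seq (seq A), forbids_pairs F & H = sft1 F.

(* A finite pattern is a finite list of (position, letter) cells. Repeated
   cells are harmless, and a list giving two letters to one position occurs
   nowhere, so that forbidding it has no effect. *)
Definition pattern2 (B : finType) : Type := seq ((int * int) * B).

Definition pattern_at (B : finType) (x : config2 B) (u : int * int)
    (p : pattern2 B) : Prop :=
  forall c, c \in p -> x (u + c.1) = c.2.

Definition sft2 (B : finType) (F : seq (pattern2 B)) : set (config2 B) :=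
  [set x | forall p, p \in F -> forall u, ~ pattern_at x u p].

Definition is_sft2 (B : finType) (Y : set (config2 B)) : Prop :=
  exists F : seq (pattern2 B), Y = sft2 F.

Definition combined (A : finType) (H V : set (config1 A)) : set (config2 A) :=
  [set x | forall i j : int, H (fun k => x (k, j)) /\ V (fun l => x (i, l))].

(** Rauzy graph and condition D *)

(* Every letter of a word ab occurring in H is itself a vertex, so the edge
   relation alone determines the SCCs. *)
Definition rauzy (A : finType) (H : set (config1 A)) (a b : A) : Prop :=
  exists2 x, H x & exists i, word_at x i [:: a; b].

(* [clos_trans] requires a path of positive length, hence a transient vertex
   belongs to no SCC. *)
Definition mutually_reachable (A : finType) (E : A -> A -> Prop) (S : set A) :
    Prop :=
  forall v w, S v -> S w -> clos_trans A E v w.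

Definition is_scc (A : finType) (E : A -> A -> Prop) (S : set A) : Prop :=
  [/\ S !=set0, mutually_reachable E S &
      forall T : set A, S `<=` T -> mutually_reachable E T -> T `<=` S].

Definition reflexive_type (A : finType) (E : A -> A -> Prop) (S : set A) :
    Prop :=
  forall v, S v -> E v v.

Definition symmetric_type (A : finType) (E : A -> A -> Prop) (S : set A) :
    Prop :=
  forall v w, S v -> S w -> v <> w -> E v w -> E w v.

Definition state_split_cycle_type (A : finType) (E : A -> A -> Prop)
    (S : set A) : Prop :=
  exists (p : nat) (V : nat -> set A),
    [/\ (0 < p)%N, partition `I_p V S &
        forall i v w, (i < p)%N -> V i v -> S w ->
          (E v w <-> V (i.+1 %% p)%N w)].

Definition condition_D (A : finType) (E : A -> A -> Prop) : Prop :=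
  [\/ forall S, is_scc E S -> reflexive_type E S,
      forall S, is_scc E S -> symmetric_type E S |
      forall S, is_scc E S -> state_split_cycle_type E S].

(** Roots *)

Definition shift (A : finType) (v : int * int) (x : config2 A) : config2 A :=
  fun k => x (k - v).

(* Z and Y, used as types, carry the subspace topology, as does X in the
   requirement that Z be clopen in X. As shift by (k1 m, k2 n) sends Z to
   itself, the equivariance clause quantifies over the element x' of Z lying
   over the shift of x. *)
Definition is_root (A B : finType) (m n : nat)
    (X : set (config2 A)) (Y : set (config2 B)) : Prop :=
  exists Z : set (config2 A),
    [/\ Z `<=` X /\ clopen [set x : X | Z (set_val x)],
        shift (m%:Z, 0) @` Z = Z,
        shift (0, n%:Z) @` Z = Z,
        exists (phi : Z -> Y) (psi : Y -> Z),
          [/\ continuous phi, continuous psi, cancel phi psi, cancel psi phi &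
              forall (k1 k2 : int) (x x' : Z),
                set_val x' = shift (k1 * m%:Z, k2 * n%:Z) (set_val x) ->
                set_val (phi x') = shift (k1, k2) (set_val (phi x))] &
        let D := [set ij : nat * nat | (ij.1 < m)%N && (ij.2 < n)%N] in
        let F ij := shift (ij.1%:Z, ij.2%:Z) @` Z in
        X = \bigcup_(ij in D) F ij /\ trivIset D F].

(** Partial recursive functions *)

Inductive murec : nat -> Type :=
| MZero : murec 0
| MSucc : murec 1
| MProj k (i : 'I_k) : murec k
| MComp k l (f : murec l) (g : 'I_l -> murec k) : murec k
| MPrim k (f : murec k) (g : murec k.+2) : murec k.+1
| MMin k (f : murec k.+1) : murec k.

(* [computes f v y]: the evaluation of f on v halts with value y. In the
   primitive recursion case the recursion variable is the first argument, and
   s is the sequence of the successive values. *)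
Fixpoint computes k (f : murec k) : k.-tuple nat -> nat -> Prop :=
  match f in murec k return k.-tuple nat -> nat -> Prop with
  | MZero => fun _ y => y = 0%N
  | MSucc => fun v y => y = (thead v).+1
  | MProj _ i => fun v y => y = tnth v i
  | MComp _ l f g => fun v y =>
      exists2 w : l.-tuple nat,
        forall i, computes (g i) v (tnth w i) & computes f w y
  | MPrim _ f g => fun v y =>
      exists s : nat -> nat,
        [/\ computes f [tuple of behead v] (s 0%N),
            forall i, (i < thead v)%N ->
              computes g [tuple of i :: s i :: behead v] (s i.+1) &
            y = s (thead v)]
  | MMin _ f => fun v y =>
      computes f [tuple of y :: v] 0%N /\
      forall i, (i < y)%N -> exists z, computes f [tuple of i :: v] z.+1
  end.

(** Encoding of descriptions by natural numbers *)

Definition enc_letter (A : finType) (a : A) : nat := enum_rank a.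

Definition enc_int (z : int) : nat :=
  match z with Posz n => n.*2 | Negz n => n.*2.+1 end.

Definition enc_seq (T : Type) (enc : T -> nat) (s : seq T) : nat :=
  CodeSeq.code (map enc s).

Definition enc_words (A : finType) (F : seq (seq A)) : nat :=
  enc_seq (enc_seq (@enc_letter A)) F.

Definition enc_cell (B : finType) (c : (int * int) * B) : nat :=
  CodeSeq.code [:: enc_int c.1.1; enc_int c.1.2; enc_letter c.2].

Definition enc_patterns (B : finType) (F : seq (pattern2 B)) : nat :=
  enc_seq (enc_seq (@enc_cell B)) F.

Definition enc_input (A B : finType) (FH : seq (seq A))
    (FY : seq (pattern2 B)) : 4.-tuple nat :=
  [tuple #|A|; #|B|; enc_words FH; enc_patterns FY].

Definition enc_output (A : finType) (m n : nat) (FV : seq (seq A)) : nat :=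
  CodeSeq.code [:: m; n; enc_words FV].

(* Main.v *)
(** Fix a large period [m].  A finite family of closed walks of length [m] in the
    graph of [H], stacked vertically and repeated with horizontal period [m], is
    laid out in rows; [V] prescribes the vertical words formed by its columns.
    Let [E] be the edge relation.  Two columns [i] and [i'] can be adjacent only
    if every walk of the family has an edge from its [i]-th to its [i']-th
    vertex.  If the family is rich enough, this implies, with [d = i' - i]
    modulo [m], that in every SCC any [v] and [w] at distance [d] along a closed
    walk of length [m] satisfy [E v w]: for [d = 0] all SCCs are reflexive, for
    [d = -1] they are symmetric, and for any other [d <> 1], iterating this
    property, [E] contains [E^(N+1)] where [E^N] is idempotent, so that they
    are state-split cycles.  When condition D fails, adjacent columns of a
    configuration are thus forced to be consecutive columns of the layout; a
    header made of rotations of a closed walk through a vertex without loop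
    forces them to be aligned vertically as well.

    In an SCC that is not a state-split cycle there are two closed walks that
    coincide except on a segment of consecutive steps, on which at least one of
    the two ways of jumping from one to the other is not an edge.  The choice
    between them is a bit that is copied along the segment and forgotten outside
    of it.  Overlapping segments carry a window of [Y], in unary, across each
    block of [m] columns, and [V] relates, in the first column of a block, the
    window of this block with that of the previous one.

    The algorithm searches for a list of closed walks satisfying a decidable
    condition that makes the construction work. *)

Require Import Defs.
From mathcomp Require Import all_boot all_order all_algebra.
From mathcomp Require Import all_classical.
From mathcomp Require Import topology_structure discrete_topology.
From mathcomp Require Import initial_topology supremum_topology.
From mathcomp Require Import function_spaces subtype_topology.
From Stdlib Require Import Relation_Operators.
From mathcomp Require Import zify.

Set Implicit Arguments.
Unset Strict Implicit.
Unset Printing Implicit Defensive.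

Import GRing.Theory Num.Theory.

(** * Primitive recursion on codes of sequences *)

Definition prim k (f : seq nat -> nat) : Prop :=
  exists c : murec k, forall v : k.-tuple nat, computes c v (f v).

Lemma prim_eq k f g :
  (forall v, size v = k -> f v = g v) -> prim k f -> prim k g.
Proof.
by move=> fg [c cP]; exists c => v; rewrite -fg ?size_tuple.
Qed.

Lemma prim_nth k i : i < k -> prim k (fun v => nth 0 v i).
Proof.
move=> ik; exists (MProj (Ordinal ik)) => v /=.
by rewrite (tnth_nth 0).
Qed.

Lemma prim_comp k (gs : seq (seq nat -> nat)) f :
  prim (size gs) f ->
  (forall i, i < size gs -> prim k (nth (fun=> 0) gs i)) ->
  prim k (fun v => f [seq g v | g <- gs]).
Proof.
move=> [c cP] gsP.
have /choice[d dP] (i : 'I_(size gs)) : exists c : murec k,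
    forall v : k.-tuple nat, computes c v (nth (fun=> 0) gs i v).
  exact: gsP.
exists (MComp c d) => v.
pose w := [seq g (val v) | g <- gs].
have sw : size w == size gs by rewrite size_map.
exists (Tuple sw); last exact: cP.
by move=> i; rewrite (tnth_nth 0) /= (nth_map (fun=> 0)).
Qed.

Lemma prim_rec k f g : prim k f -> prim k.+2 g ->
  prim k.+1 (fun v => nat_rect (fun=> nat) (f (behead v))
                        (fun i a => g [:: i, a & behead v]) (head 0 v)).
Proof.
move=> [c cP] [d dP]; exists (MPrim c d) => v /=.
have hv : thead v = head 0 v by rewrite (tuple_eta v).
exists (fun n => nat_rect (fun=> nat) (f (behead v))
   (fun i a => g [:: i, a & behead v]) n); split=> //=.
- exact: (cP [tuple of behead v]).
- by move=> i _; apply: dP.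
- by rewrite hv.
Qed.

Lemma prim_comp1 k f g : prim 1 (fun v => f (nth 0 v 0)) -> prim k g ->
  prim k (fun v => f (g v)).
Proof. by move=> fP gP; apply: (@prim_comp k [:: g] _ fP) => -[]. Qed.

Lemma prim_comp2 k f g h : prim 2 (fun v => f (nth 0 v 0) (nth 0 v 1)) ->
  prim k g -> prim k h -> prim k (fun v => f (g v) (h v)).
Proof.
by move=> fP gP hP; apply: (@prim_comp k [:: g; h] _ fP) => -[|[]].
Qed.

Lemma prim_comp3 k f g h l :
  prim 3 (fun v => f (nth 0 v 0) (nth 0 v 1) (nth 0 v 2)) ->
  prim k g -> prim k h -> prim k l -> prim k (fun v => f (g v) (h v) (l v)).
Proof.
by move=> fP gP hP lP; apply: (@prim_comp k [:: g; h; l] _ fP) => -[|[|[]]].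
Qed.

Lemma prim_succ k f : prim k f -> prim k (fun v => (f v).+1).
Proof.
apply: prim_comp1; exists MSucc => v /=.
by rewrite (tuple_eta v).
Qed.

Lemma prim_const k n : prim k (fun=> n).
Proof.
elim: n => [|n IHn]; last exact: prim_succ.
have p0 : prim 0 (fun=> 0) by exists MZero.
exact: (@prim_comp k [::] (fun=> 0) p0).
Qed.

Lemma prim_nat_rect k s f g : prim k s -> prim k f ->
  prim k.+2 (fun v => g (nth 0 v 0) (nth 0 v 1) (drop 2 v)) ->
  prim k (fun v => nat_rect (fun=> nat) (f v) (fun i a => g i a v) (s v)).
Proof.
move=> sP fP gP.
pose F v := nat_rect (fun=> nat) (f (behead v))
              (fun i a => g i a (behead v)) (head 0 v).
have FP : prim k.+1 F.
  by move: (prim_rec fP gP); apply: prim_eq => v _ /=; rewrite drop0.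
pose gs := s :: [seq (fun v : seq nat => nth 0 v i) | i <- iota 0 k].
have sgs : size gs = k.+1 by rewrite /= size_map size_iota.
rewrite -sgs in FP; move: (@prim_comp k gs F FP); rewrite sgs => H.
apply: prim_eq (H _) => [v sv|[|i] //=]; last first.
  rewrite ltnS => ik; rewrite (nth_map 0) ?size_iota // nth_iota // add0n.
  exact: prim_nth.
by rewrite /F /= -map_comp -sv map_nth_iota0 // take_size.
Qed.

Lemma prim_add k f g : prim k f -> prim k g -> prim k (fun v => f v + g v).
Proof.
apply: prim_comp2.
apply: (@prim_eq _ (fun v => nat_rect (fun=> nat) (nth 0 v 1) (fun _ a => a.+1) (nth 0 v 0))).
  by move=> v _; elim: (nth 0 v 0) => //= n ->.
apply: (@prim_nat_rect _ (fun v => nth 0 v 0) (fun v => nth 0 v 1)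
  (fun i a v => a.+1)); try exact: prim_nth.
by apply: prim_succ; apply: prim_nth.
Qed.

Lemma prim_mul k f g : prim k f -> prim k g -> prim k (fun v => f v * g v).
Proof.
apply: prim_comp2.
apply: (@prim_eq _ (fun v => nat_rect (fun=> nat) 0 (fun _ a => nth 0 v 1 + a) (nth 0 v 0))).
  by move=> v _; elim: (nth 0 v 0) => //= n ->.
apply: (@prim_nat_rect _ (fun v => nth 0 v 0) (fun=> 0)
  (fun i a v => nth 0 v 1 + a)); try exact: prim_nth; first exact: prim_const.
apply: (@prim_eq _ (fun v => nth 0 v 3 + nth 0 v 1)).
  by move=> v _; rewrite nth_drop.
by apply: prim_add; apply: prim_nth.
Qed.

Lemma prim_pred k f : prim k f -> prim k (fun v => (f v).-1).
Proof.
apply: prim_comp1.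
apply: (@prim_eq _ (fun v => nat_rect (fun=> nat) 0 (fun i _ => i) (nth 0 v 0))).
  by move=> v _; case: (nth 0 v 0).
apply: (@prim_nat_rect _ (fun v => nth 0 v 0) (fun=> 0) (fun i a v => i));
  by [exact: prim_nth | exact: prim_const].
Qed.

Lemma prim_sub k f g : prim k f -> prim k g -> prim k (fun v => f v - g v).
Proof.
apply: prim_comp2.
apply: (@prim_eq _ (fun v => nat_rect (fun=> nat) (nth 0 v 0) (fun _ a => a.-1) (nth 0 v 1))).
  by move=> v _; elim: (nth 0 v 1) => [|n IH] /=; rewrite ?subn0 // IH subnS.
apply: (@prim_nat_rect _ (fun v => nth 0 v 1) (fun v => nth 0 v 0)
  (fun i a v => a.-1)); try exact: prim_nth.
by apply: prim_pred; apply: prim_nth.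
Qed.

Lemma prim_if k f g h : prim k f -> prim k g -> prim k h ->
  prim k (fun v => if f v is 0 then h v else g v).
Proof.
move=> fP gP hP.
apply: (@prim_comp3 k (fun a b c => if a is 0 then c else b)) => //.
apply: (@prim_eq _ (fun v => nat_rect (fun=> nat) (nth 0 v 2) (fun _ _ => nth 0 v 1) (nth 0 v 0))).
  by move=> v _; case: (nth 0 v 0).
apply: (@prim_nat_rect _ (fun v => nth 0 v 0) (fun v => nth 0 v 2)
  (fun i a v => nth 0 v 1)); try exact: prim_nth.
apply: (@prim_eq _ (fun v => nth 0 v 3)); last exact: prim_nth.
by move=> v _; rewrite nth_drop.
Qed.

Lemma prim_leq k f g : prim k f -> prim k g ->
  prim k (fun v => (f v <= g v) : nat).
Proof.
move=> fP gP; apply: prim_eq (prim_if (prim_sub fP gP) (prim_const k 0) (prim_const k 1)).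
by move=> v _; rewrite -subn_eq0; case: (f v - g v).
Qed.

Lemma prim_eqn k f g : prim k f -> prim k g ->
  prim k (fun v => (f v == g v) : nat).
Proof.
move=> fP gP; apply: prim_eq (prim_mul (prim_leq fP gP) (prim_leq gP fP)).
by move=> v _; rewrite eqn_leq mulnb.
Qed.

Lemma prim_odd k f : prim k f -> prim k (fun v => odd (f v) : nat).
Proof.
apply: (@prim_comp1 k (fun n => odd n : nat)).
apply: (@prim_eq _ (fun v => nat_rect (fun=> nat) 0 (fun _ a => 1 - a) (nth 0 v 0))).
  by move=> v _; elim: (nth 0 v 0) => //= n ->; case: odd.
apply: (@prim_nat_rect _ (fun v => nth 0 v 0) (fun=> 0) (fun i a v => 1 - a));
  [exact: prim_nth | exact: prim_const|].
by apply: prim_sub; [exact: prim_const | exact: prim_nth].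
Qed.

Lemma prim_half k f : prim k f -> prim k (fun v => (f v)./2).
Proof.
apply: prim_comp1.
apply: (@prim_eq _ (fun v => nat_rect (fun=> nat) 0 (fun i a => a + odd i) (nth 0 v 0))).
  by move=> v _; elim: (nth 0 v 0) => //= n ->; rewrite uphalf_half addnC.
apply: (@prim_nat_rect _ (fun v => nth 0 v 0) (fun=> 0) (fun i a v => a + odd i));
  [exact: prim_nth | exact: prim_const|].
by apply: prim_add; [|apply: prim_odd]; exact: prim_nth.
Qed.

Lemma prim_exp2 k f : prim k f -> prim k (fun v => 2 ^ f v).
Proof.
apply: prim_comp1.
apply: (@prim_eq _ (fun v => nat_rect (fun=> nat) 1 (fun _ a => a + a) (nth 0 v 0))).
  by move=> v _; elim: (nth 0 v 0) => //= n ->; rewrite expnS mul2n addnn.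
apply: (@prim_nat_rect _ (fun v => nth 0 v 0) (fun=> 1) (fun i a v => a + a));
  [exact: prim_nth | exact: prim_const|].
by apply: prim_add; exact: prim_nth.
Qed.

Definition shr i c := nat_rect (fun=> nat) c (fun _ a => a./2) i.

Lemma shrM i c : shr i (2 ^ i * c) = c.
Proof.
elim: i c => [|i IH] c; first by rewrite mul1n.
rewrite /= -/(shr i _) expnS -mulnA mulnCA IH mul2n; exact: doubleK.
Qed.

Lemma prim_shr k f g : prim k f -> prim k g -> prim k (fun v => shr (f v) (g v)).
Proof.
move=> fP gP; apply: prim_nat_rect => //.
by apply: prim_half; exact: prim_nth.
Qed.

Definition code_head c :=
  nat_rect (fun=> nat) 0 (fun i a => a + (2 ^ i.+1 * shr i.+1 c == c)) c.

Definition code_tail c := (shr (code_head c) c)./2.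

Lemma code_cons n s : CodeSeq.code (n :: s) = 2 ^ n * (CodeSeq.code s).*2.+1.
Proof. by []. Qed.

Lemma code_headE n s : code_head (CodeSeq.code (n :: s)) = n.
Proof.
rewrite code_cons; set c := _ * _; set d := (CodeSeq.code s).*2.+1.
have cn : n < c by rewrite /c (leq_trans (ltn_expl n (isT : 1 < 2))) ?leq_pmulr.
rewrite /code_head.
have H i : (2 ^ i.+1 * shr i.+1 c == c) = (i < n).
  case: (ltnP i n) => [lin|nli].
    by rewrite /c -(subnKC lin) expnD -mulnA shrM eqxx.
  apply/negbTE/eqP; rewrite {2}/c -(subnKC nli) -addnS expnD -mulnA.
  move/eqP; rewrite eqn_pmul2l ?expn_gt0 // => /eqP /(congr1 odd).
  by rewrite /d /= odd_double expnS -mulnA mul2n odd_double.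
have G j : nat_rect (fun=> nat) 0
    (fun i a => a + (2 ^ i.+1 * shr i.+1 c == c)) j = minn j n.
  by elim: j => [|j IH]; [rewrite min0n | rewrite [LHS]/= IH -/(shr j.+1 c) H; lia].
by rewrite G; apply/minn_idPr/ltnW.
Qed.

Lemma code_tailE n s : code_tail (CodeSeq.code (n :: s)) = CodeSeq.code s.
Proof. by rewrite /code_tail code_headE code_cons shrM /= uphalf_double. Qed.

Lemma prim_code_head k f : prim k f -> prim k (fun v => code_head (f v)).
Proof.
apply: (@prim_comp1 k code_head).
apply: (@prim_nat_rect 1 (fun v => nth 0 v 0) (fun=> 0)
  (fun i a v => a + (2 ^ i.+1 * shr i.+1 (nth 0 v 0) == nth 0 v 0)));
  [exact: prim_nth | exact: prim_const|].
have p0 : prim 3 (fun v => (nth 0 v 0).+1) by apply/prim_succ/prim_nth.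
have p2 : prim 3 (fun v => nth 0 (drop 2 v) 0).
  by apply: prim_eq (@prim_nth 3 2 isT) => v _; rewrite nth_drop.
apply: prim_add; first exact: prim_nth.
by apply: prim_eqn => //; apply: prim_mul; [apply: prim_exp2|apply: prim_shr].
Qed.

Lemma prim_code_tail k f : prim k f -> prim k (fun v => code_tail (f v)).
Proof.
by move=> fP; apply: prim_half; apply: prim_shr => //; apply: prim_code_head.
Qed.

Lemma prim_code_cons k f g : prim k f -> prim k g ->
  prim k (fun v => 2 ^ f v * (g v).*2.+1).
Proof.
move=> fP gP; apply: prim_mul; first exact: prim_exp2.
by apply/prim_succ/(@prim_eq _ (fun v => g v + g v)) => [v _|];
  rewrite ?addnn //; apply: prim_add.
Qed.

Definition code_drop i c := nat_rect (fun=> nat) c (fun _ a => code_tail a) i.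

Lemma code_dropE i s : code_drop i (CodeSeq.code s) = CodeSeq.code (drop i s).
Proof.
rewrite /code_drop; elim: i s => [|i IH] s; first by rewrite drop0.
rewrite [LHS]/= IH -addn1 addnC -drop_drop.
case: (drop i s) => //= a t; rewrite drop0; exact: (code_tailE a t).
Qed.

Lemma prim_code_drop k f g : prim k f -> prim k g ->
  prim k (fun v => code_drop (f v) (g v)).
Proof.
move=> fP gP; apply: prim_nat_rect => //.
by apply: prim_code_tail; exact: prim_nth.
Qed.

(* The accumulator is kept unchanged once the list is exhausted, so the code
   of the list itself is a large enough number of steps. *)
Definition code_foldl (g : nat -> nat -> nat) z c :=
  nat_rect (fun=> nat) z (fun i a =>
    if code_drop i c is 0 then a else g a (code_head (code_drop i c))) c.

Lemma size_code s : size s <= CodeSeq.code s.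
Proof.
elim: s => //= n s IH.
have : 0 < 2 ^ n by rewrite expn_gt0.
rewrite -muln2; nia.
Qed.

Lemma code_foldlE g z s : code_foldl g z (CodeSeq.code s) = foldl g z s.
Proof.
rewrite /code_foldl.
have H i : nat_rect (fun=> nat) z (fun i a =>
    if code_drop i (CodeSeq.code s) is 0 then a
    else g a (code_head (code_drop i (CodeSeq.code s)))) i
    = foldl g z (take i s).
  elim: i => [|i IH]; first by rewrite take0.
  rewrite [LHS]/= IH code_dropE.
  have [si|lis] := leqP (size s) i.
    by rewrite drop_oversize //= !take_oversize // leqW.
  rewrite (drop_nth 0) // (take_nth 0) // -cats1 foldl_cat [RHS]/=.
  have : 0 < CodeSeq.code (nth 0 s i :: drop i.+1 s).
    by rewrite code_cons muln_gt0 expn_gt0.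
  by move: (code_headE (nth 0 s i) (drop i.+1 s)); case: CodeSeq.code => // c ->.
by rewrite H take_oversize // size_code.
Qed.

Lemma prim_code_foldl k c z g : prim k c -> prim k z ->
  prim k.+2 (fun v => g (nth 0 v 0) (nth 0 v 1) (drop 2 v)) ->
  prim k (fun v => code_foldl (fun a x => g a x v) (z v) (c v)).
Proof.
move=> cP zP gP.
have wk f : prim k f -> prim k.+2 (fun v => f (drop 2 v)).
  move=> fP.
  pose gs := [seq (fun v : seq nat => nth 0 v i) | i <- iota 2 k].
  have sgs : size gs = k by rewrite size_map size_iota.
  rewrite -sgs in fP; move: (@prim_comp k.+2 gs f fP); rewrite sgs => H.
  apply: prim_eq (H _) => [v sv|i ik].
    rewrite -map_comp /comp map_nth_iota ?take_oversize ?size_drop ?sv ?subn2 //.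
  by rewrite (nth_map 0) ?size_iota // nth_iota //; apply: prim_nth; lia.
have dP : prim k.+2 (fun v => code_drop (nth 0 v 0) (c (drop 2 v))).
  by apply: prim_code_drop; [exact: prim_nth|exact: wk].
apply: (@prim_nat_rect k c z (fun i a v => if code_drop i (c v) is 0 then a
  else g a (code_head (code_drop i (c v))) v)) => //.
apply: prim_if => //; last exact: prim_nth.
pose gs := [:: (fun v => nth 0 v 1),
  (fun v => code_head (code_drop (nth 0 v 0) (c (drop 2 v)))) &
  [seq (fun v : seq nat => nth 0 v i) | i <- iota 2 k]].
have sgs : size gs = k.+2 by rewrite /= size_map size_iota.
rewrite -sgs in gP; move: (@prim_comp k.+2 gs _ gP); rewrite sgs => H.
apply: prim_eq (H _) => [v sv|[|[|i]] //=].
- rewrite /= drop0 -map_comp /comp map_nth_iota ?take_oversize ?size_drop ?sv ?subn2 //.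
- by move=> _; exact: prim_nth.
- by move=> _; exact: prim_code_head.
by rewrite !ltnS => ik; rewrite (nth_map 0) ?size_iota // nth_iota //; apply: prim_nth; lia.
Qed.

(** * Typed computable functions *)

Class codable (T : Type) := code_of : T -> nat.

#[export] Instance codable_nat : codable nat := id.
#[export] Instance codable_bool : codable bool := nat_of_bool.
#[export] Instance codable_seq T `{codable T} : codable (seq T) :=
  fun s => CodeSeq.code (map code_of s).
#[export] Instance codable_prod T U `{codable T} `{codable U} :
  codable (T * U) := fun p => CodeSeq.code [:: code_of p.1; code_of p.2].

Definition comput T U `{codable T} `{codable U} (f : T -> U) : Prop :=
  exists2 g, prim 1 (fun v => g (nth 0 v 0)) &
    forall x, g (code_of x) = code_of (f x).

Lemma comput_id T `{codable T} : comput (fun x : T => x).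
Proof. by exists id => //; apply: prim_nth. Qed.

Lemma comput_const T U `{codable T} `{codable U} (u : U) :
  comput (fun _ : T => u).
Proof. by exists (fun=> code_of u) => //; apply: prim_const. Qed.

Lemma comput_comp T U W `{codable T} `{codable U} `{codable W}
    (F : U -> W) (f : T -> U) :
  comput F -> comput f -> comput (fun c => F (f c)).
Proof.
move=> [g gP gE] [h hP hE]; exists (fun n => g (h n)); first exact: prim_comp1.
by move=> x; rewrite hE gE.
Qed.

Lemma comput_pair T U W `{codable T} `{codable U} `{codable W}
    (f : T -> U) (g : T -> W) :
  comput f -> comput g -> comput (fun c => (f c, g c)).
Proof.
move=> [f' fP fE] [g' gP gE].
exists (fun n => 2 ^ f' n * (2 ^ g' n * 1).*2.+1) => [|x]; last by rewrite fE gE.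
apply: prim_code_cons => //.
by apply: (@prim_code_cons 1 _ (fun=> 0)) => //; apply: prim_const.
Qed.

Lemma comput_fst T U W `{codable T} `{codable U} `{codable W}
    (f : T -> U * W) : comput f -> comput (fun c => (f c).1).
Proof.
move=> [g gP gE]; exists (fun n => code_head (g n)).
  exact: prim_code_head.
by move=> x; rewrite gE; apply: code_headE.
Qed.

Lemma comput_snd T U W `{codable T} `{codable U} `{codable W}
    (f : T -> U * W) : comput f -> comput (fun c => (f c).2).
Proof.
move=> [g gP gE]; exists (fun n => code_head (code_tail (g n))).
  by apply: prim_code_head; apply: prim_code_tail.
by move=> x; rewrite gE [code_of (f x)]/code_of /= code_tailE code_headE.
Qed.

Lemma comput_comp2 T U V W `{codable T} `{codable U} `{codable V} `{codable W}
    (F : U -> V -> W) (f : T -> U) (g : T -> V) :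
  comput (fun p => F p.1 p.2) -> comput f -> comput g ->
  comput (fun c => F (f c) (g c)).
Proof.
move=> FP fP gP.
exact: (comput_comp FP (comput_pair fP gP)).
Qed.

Lemma comput_comp3 T U V W Z `{codable T} `{codable U} `{codable V} `{codable W}
    `{codable Z} (F : U -> V -> W -> Z) (f : T -> U) (g : T -> V) (h : T -> W) :
  comput (fun p => F p.1.1 p.1.2 p.2) -> comput f -> comput g -> comput h ->
  comput (fun c => F (f c) (g c) (h c)).
Proof.
move=> FP fP gP hP.
exact: (comput_comp FP (comput_pair (comput_pair fP gP) hP)).
Qed.

Lemma comput_nat2 T U `{codable T} `{codable U} (F : nat -> nat -> U)
    (f g : T -> nat) :
  prim 1 (fun v => code_of (F (code_head (nth 0 v 0))
                     (code_head (code_tail (nth 0 v 0))))) ->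
  comput f -> comput g -> comput (fun c => F (f c) (g c)).
Proof.
move=> FP; apply: comput_comp2.
exists (fun n => code_of (F (code_head n) (code_head (code_tail n)))) => //.
by case=> a b; rewrite /code_of /codable_prod code_tailE !code_headE.
Qed.

Lemma prim_pi1 : prim 1 (fun v => code_head (nth 0 v 0)).
Proof. by apply: prim_code_head; apply: prim_nth. Qed.

Lemma prim_pi2 : prim 1 (fun v => code_head (code_tail (nth 0 v 0))).
Proof. by apply: prim_code_head; apply: prim_code_tail; apply: prim_nth. Qed.

Lemma comput_add T `{codable T} (f g : T -> nat) :
  comput f -> comput g -> comput (fun c => f c + g c).
Proof.
by apply: comput_nat2; apply: prim_add; [exact: prim_pi1|exact: prim_pi2].
Qed.

Lemma comput_sub T `{codable T} (f g : T -> nat) :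
  comput f -> comput g -> comput (fun c => f c - g c).
Proof.
by apply: comput_nat2; apply: prim_sub; [exact: prim_pi1|exact: prim_pi2].
Qed.

Lemma comput_mul T `{codable T} (f g : T -> nat) :
  comput f -> comput g -> comput (fun c => f c * g c).
Proof.
by apply: comput_nat2; apply: prim_mul; [exact: prim_pi1|exact: prim_pi2].
Qed.

Lemma comput_leq T `{codable T} (f g : T -> nat) :
  comput f -> comput g -> comput (fun c => f c <= g c).
Proof.
by apply: comput_nat2; apply: prim_leq; [exact: prim_pi1|exact: prim_pi2].
Qed.

Lemma comput_succ T `{codable T} (f : T -> nat) :
  comput f -> comput (fun c => (f c).+1).
Proof.
apply: (comput_comp (F := succn)).
by exists succn => //; apply: prim_succ; apply: prim_nth.
Qed.

Lemma comput_half T `{codable T} (f : T -> nat) :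
  comput f -> comput (fun c => (f c)./2).
Proof.
apply: (comput_comp (F := half)).
by exists half => //; apply: prim_half; apply: prim_nth.
Qed.

Lemma comput_odd T `{codable T} (f : T -> nat) :
  comput f -> comput (fun c => odd (f c)).
Proof.
apply: (comput_comp (F := odd)).
by exists (fun n => odd n : nat) => //; apply: prim_odd; apply: prim_nth.
Qed.

Lemma comput_if T U `{codable T} `{codable U} (b : T -> bool) (f g : T -> U) :
  comput b -> comput f -> comput g -> comput (fun c => if b c then f c else g c).
Proof.
move=> [b' bP bE] [f' fP fE] [g' gP gE].
exists (fun n => if b' n is 0 then g' n else f' n); first exact: prim_if.
by move=> x; rewrite bE fE gE; case: (b x).
Qed.

Lemma comput_and T `{codable T} (b d : T -> bool) :
  comput b -> comput d -> comput (fun c => b c && d c).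
Proof. by move=> bP dP; apply: comput_if => //; apply: comput_const. Qed.

Lemma comput_or T `{codable T} (b d : T -> bool) :
  comput b -> comput d -> comput (fun c => b c || d c).
Proof. by move=> bP dP; apply: comput_if => //; apply: comput_const. Qed.

Lemma comput_neg T `{codable T} (b : T -> bool) :
  comput b -> comput (fun c => ~~ b c).
Proof. by move=> bP; apply: comput_if => //; apply: comput_const. Qed.

Lemma code_of_seq_inj T `{codable T} :
  injective (code_of : T -> nat) -> injective (code_of : seq T -> nat).
Proof. by move=> inj s t /(can_inj CodeSeq.codeK) /(inj_map inj). Qed.

Lemma comput_eq T (U : eqType) `{codable T} `{codable U} (f g : T -> U) :
  injective (code_of : U -> nat) ->
  comput f -> comput g -> comput (fun c => f c == g c).
Proof.
move=> inj [f' fP fE] [g' gP gE].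
exists (fun n => (f' n == g' n) : nat); first exact: prim_eqn.
by move=> x; rewrite fE gE (inj_eq inj).
Qed.

Lemma comput_cons T U `{codable T} `{codable U} (f : T -> U) (g : T -> seq U) :
  comput f -> comput g -> comput (fun c => f c :: g c).
Proof.
move=> [f' fP fE] [g' gP gE].
exists (fun n => 2 ^ f' n * (g' n).*2.+1) => [|x]; last by rewrite fE gE.
exact: prim_code_cons.
Qed.

Lemma comput_foldl T U W `{codable T} `{codable U} `{codable W}
    (F : T -> W -> U -> W) (z : T -> W) (l : T -> seq U) :
  comput (fun p : T * W * U => F p.1.1 p.1.2 p.2) ->
  comput z -> comput l -> comput (fun c => foldl (F c) (z c) (l c)).
Proof.
move=> [F' FP FE] [z' zP zE] [l' lP lE].
pose pr a b := CodeSeq.code [:: a; b].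
exists (fun n => code_foldl (fun a x => F' (pr (pr n a) x)) (z' n) (l' n)).
  apply: (@prim_code_foldl 1 (fun v => l' (nth 0 v 0)) (fun v => z' (nth 0 v 0))
    (fun a x v => F' (pr (pr (nth 0 v 0) a) x))) => //.
  have prP f g : prim 3 f -> prim 3 g -> prim 3 (fun v => pr (f v) (g v)).
    move=> fP gP; apply: prim_code_cons => //.
    by apply: (@prim_code_cons 3 _ (fun=> 0)) => //; apply: prim_const.
  apply: prim_comp1 FP _; apply: (prP); last exact: prim_nth.
  apply: (prP); last exact: prim_nth.
  by apply: (@prim_eq _ (fun v => nth 0 v 2)); [move=> v _; rewrite nth_drop|exact: prim_nth].
move=> x; rewrite zE lE code_foldlE.
elim: (l x) (z x) => //= u s IH a.
by rewrite -IH -(FE (x, a, u)).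
Qed.

Lemma comput_iteri T W `{codable T} `{codable W}
    (F : T -> nat -> W -> W) (n : T -> nat) (z : T -> W) :
  comput (fun p : T * nat * W => F p.1.1 p.1.2 p.2) ->
  comput n -> comput z -> comput (fun c => iteri (n c) (F c) (z c)).
Proof.
move=> [F' FP FE] [n' nP nE] [z' zP zE].
pose pr a b := CodeSeq.code [:: a; b].
exists (fun m => nat_rect (fun=> nat) (z' m) (fun i a => F' (pr (pr m i) a)) (n' m)).
  apply: (@prim_nat_rect 1 (fun v => n' (nth 0 v 0)) (fun v => z' (nth 0 v 0))
    (fun i a v => F' (pr (pr (nth 0 v 0) i) a))) => //.
  have prP f g : prim 3 f -> prim 3 g -> prim 3 (fun v => pr (f v) (g v)).
    move=> fP gP; apply: prim_code_cons => //.
    by apply: (@prim_code_cons 3 _ (fun=> 0)) => //; apply: prim_const.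
  apply: prim_comp1 FP _; apply: (prP); last exact: prim_nth.
  apply: (prP); last exact: prim_nth.
  by apply: (@prim_eq _ (fun v => nth 0 v 2)); [move=> v _; rewrite nth_drop|exact: prim_nth].
move=> x; rewrite zE nE [code_of (n x)]/code_of /codable_nat.
elim: (n x) => //= i ->.
by rewrite -(FE (x, i, _)).
Qed.

Lemma comput_eqf T U `{codable T} `{codable U} (f g : T -> U) :
  f =1 g -> comput f -> comput g.
Proof. by move=> /funext ->. Qed.

Ltac comput_lib := fail.

Ltac comput_step :=
  first [ assumption |
  lazymatch goal with
  | |- comput (fun c => c) => exact comput_id
  | |- comput (fun _ => ?u) => exact (comput_const u)
  | |- comput fst => exact (comput_fst comput_id)
  | |- comput snd => exact (comput_snd comput_id)
  | |- comput (fun c => fst (@?f c)) => refine (comput_fst (f := f) _)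
  | |- comput (fun c => snd (@?f c)) => refine (comput_snd (f := f) _)
  | |- comput (fun c => pair (@?f c) (@?g c)) =>
      refine (comput_pair (f := f) (g := g) _ _)
  | |- comput (fun c => cons (@?f c) (@?g c)) =>
      refine (comput_cons (f := f) (g := g) _ _)
  | |- comput (fun c => andb (@?f c) (@?g c)) =>
      refine (comput_and (b := f) (d := g) _ _)
  | |- comput (fun c => orb (@?f c) (@?g c)) =>
      refine (comput_or (b := f) (d := g) _ _)
  | |- comput (fun c => negb (@?f c)) => refine (comput_neg (b := f) _)
  | |- comput (fun c => S (@?f c)) => refine (comput_succ (f := f) _)
  | |- comput (fun c => addn (@?f c) (@?g c)) =>
      refine (comput_add (f := f) (g := g) _ _)
  | |- comput (fun c => subn (@?f c) (@?g c)) =>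
      refine (comput_sub (f := f) (g := g) _ _)
  | |- comput (fun c => muln (@?f c) (@?g c)) =>
      refine (comput_mul (f := f) (g := g) _ _)
  | |- comput (fun c => leq (@?f c) (@?g c)) =>
      refine (comput_leq (f := f) (g := g) _ _)
  | |- comput (fun c => half (@?f c)) => refine (comput_half (f := f) _)
  | |- comput (fun c => odd (@?f c)) => refine (comput_odd (f := f) _)
  | |- comput (fun c => eq_op (@?f c) (@?g c)) =>
      refine (comput_eq (f := f) (g := g) _ _ _);
        [by repeat apply: code_of_seq_inj | |]
  | |- comput (fun c => foldl (@?F c) (@?z c) (@?l c)) =>
      refine (comput_foldl (F := F) (z := z) (l := l) _ _ _)
  | |- comput (fun c => iteri (@?n c) (@?F c) (@?z c)) =>
      refine (comput_iteri (F := F) (z := z) (n := n) _ _ _)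
  end
  | match goal with
    | FP : comput ?F |- comput (fun c => ?F (@?f c)) =>
        refine (comput_comp (F := F) (f := f) FP _)
    | FP : comput (fun p => ?F (fst p) (snd p))
      |- comput (fun c => ?F (@?f c) (@?g c)) =>
        refine (comput_comp2 (F := F) (f := f) (g := g) FP _ _)
    | FP : comput (fun p => ?F (fst (fst p)) (snd (fst p)) (snd p))
      |- comput (fun c => ?F (@?f c) (@?g c) (@?h c)) =>
        refine (comput_comp3 (F := F) (f := f) (g := g) (h := h) FP _ _ _)
    end
  | comput_lib | simple apply comput_if ].

Ltac comput := repeat (cbv beta; comput_step).

Lemma comput_iter T W `{codable T} `{codable W}
    (F : T -> W -> W) (n : T -> nat) (z : T -> W) :
  comput (fun p : T * W => F p.1 p.2) ->
  comput n -> comput z -> comput (fun c => iter (n c) (F c) (z c)).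
Proof.
move=> FP nP zP.
apply: (comput_eqf (f := fun c => iteri (n c) (fun _ => F c) (z c))).
  by move=> x; elim: (n x) => //= i ->.
by comput.
Qed.

Lemma comput_rev T U `{codable T} `{codable U} (l : T -> seq U) :
  comput l -> comput (fun c => rev (l c)).
Proof.
move=> lP; apply: (comput_eqf (f := fun c => foldl (fun s x => x :: s) [::] (l c))).
  move=> x; rewrite -[rev _]cats0 -/(catrev _ _) -catrevE.
  by elim: (l x) [::] => //= a s IH t; rewrite IH.
by comput.
Qed.

Lemma comput_foldr T U W `{codable T} `{codable U} `{codable W}
    (F : T -> U -> W -> W) (z : T -> W) (l : T -> seq U) :
  comput (fun p : T * U * W => F p.1.1 p.1.2 p.2) ->
  comput z -> comput l -> comput (fun c => foldr (F c) (z c) (l c)).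
Proof.
move=> FP zP lP.
apply: (comput_eqf (f := fun c => foldl (fun w u => F c u w) (z c) (rev (l c)))).
  by move=> x; rewrite foldl_rev.
by comput; apply: comput_rev.
Qed.

Lemma comput_map T U W `{codable T} `{codable U} `{codable W}
    (F : T -> U -> W) (l : T -> seq U) :
  comput (fun p : T * U => F p.1 p.2) -> comput l ->
  comput (fun c => map (F c) (l c)).
Proof.
move=> FP lP.
apply: (comput_eqf (f := fun c => foldr (fun u s => F c u :: s) [::] (l c))).
  by move=> x; elim: (l x) => //= a s ->.
by apply: comput_foldr => //; comput.
Qed.

Lemma comput_filter T U `{codable T} `{codable U} (P : T -> U -> bool)
    (l : T -> seq U) :
  comput (fun p : T * U => P p.1 p.2) -> comput l ->
  comput (fun c => seq.filter (P c) (l c)).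
Proof.
move=> FP lP.
apply: (comput_eqf (f := fun c => foldr (fun u s => if P c u then u :: s else s) [::] (l c))).
  by move=> x; elim: (l x) => //= a s ->.
by apply: comput_foldr => //; comput.
Qed.

Lemma comput_all T U `{codable T} `{codable U} (P : T -> U -> bool)
    (l : T -> seq U) :
  comput (fun p : T * U => P p.1 p.2) -> comput l ->
  comput (fun c => all (P c) (l c)).
Proof.
move=> FP lP.
apply: (comput_eqf (f := fun c => foldr (fun u b => P c u && b) true (l c))).
  by move=> x; elim: (l x) => //= a s ->.
by apply: comput_foldr => //; comput.
Qed.

Lemma comput_has T U `{codable T} `{codable U} (P : T -> U -> bool)
    (l : T -> seq U) :
  comput (fun p : T * U => P p.1 p.2) -> comput l ->
  comput (fun c => has (P c) (l c)).
Proof.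
move=> FP lP.
apply: (comput_eqf (f := fun c => ~~ all (fun u => ~~ P c u) (l c))).
  by move=> x; rewrite (all_predC (P x)) negbK.
by apply/comput_neg/comput_all => //; apply: comput_neg.
Qed.

Lemma comput_cat T U `{codable T} `{codable U} (f g : T -> seq U) :
  comput f -> comput g -> comput (fun c => f c ++ g c).
Proof.
move=> fP gP; apply: (comput_eqf (f := fun c => foldr cons (g c) (f c))).
  by move=> x; elim: (f x) => //= a s ->.
by apply: comput_foldr => //; comput.
Qed.

Lemma comput_flatten T U `{codable T} `{codable U} (f : T -> seq (seq U)) :
  comput f -> comput (fun c => flatten (f c)).
Proof.
move=> fP; apply: comput_foldr => //; last by comput.
by apply: comput_cat; comput.
Qed.

Lemma comput_size T U `{codable T} `{codable U} (f : T -> seq U) :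
  comput f -> comput (fun c => size (f c)).
Proof.
move=> fP; apply: (comput_eqf (f := fun c => foldl (fun n _ => n.+1) 0 (f c))).
  by move=> x; rewrite -[RHS]addn0; elim: (f x) 0 => //= a s IH n; rewrite IH addnS.
by comput.
Qed.

Lemma comput_sumn T `{codable T} (f : T -> seq nat) :
  comput f -> comput (fun c => sumn (f c)).
Proof. by move=> fP; apply: comput_foldr => //; comput. Qed.

Lemma comput_iota T `{codable T} (m n : T -> nat) :
  comput m -> comput n -> comput (fun c => iota (m c) (n c)).
Proof.
move=> mP nP; apply: (comput_eqf
  (f := fun c => rev (iteri (n c) (fun i s => (m c + i) :: s) [::]))).
  move=> x; elim: (n x) => // i IH.
  by rewrite [iteri _ _ _]/= rev_cons IH -cats1 -[in RHS]addn1 iotaD.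
by apply: comput_rev; comput.
Qed.

Lemma comput_drop T U `{codable T} `{codable U} (n : T -> nat) (f : T -> seq U) :
  comput n -> comput f -> comput (fun c => drop (n c) (f c)).
Proof.
move=> nP fP; apply: (comput_eqf (f := fun c => iter (n c) behead (f c))).
  move=> x; elim: (n x) => [|i IH] /=; first by rewrite drop0.
  by rewrite IH -drop1 drop_drop add1n.
apply: comput_iter => //.
apply: (comput_comp (F := behead) _ (comput_snd comput_id)).
exists code_tail; first by apply: prim_code_tail; apply: prim_nth.
case=> [|a s] //; exact: code_tailE.
Qed.

Lemma comput_take T U `{codable T} `{codable U} (n : T -> nat) (f : T -> seq U) :
  comput n -> comput f -> comput (fun c => take (n c) (f c)).
Proof.
move=> nP fP.
apply: (comput_eqf (f := fun c => rev (drop (size (f c) - n c) (rev (f c))))).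
  move=> x; rewrite drop_rev revK; have [nf|fn] := leqP (n x) (size (f x)).
    by rewrite subKn.
  by rewrite !take_oversize ?leq_subr ?(ltnW fn) // (eqP (ltnW fn)) subn0.
do ?[apply: comput_rev|apply: comput_drop|apply: comput_sub] => //.
exact: comput_size.
Qed.

Lemma comput_nth T U `{codable T} `{codable U} (u : U) (f : T -> seq U)
    (n : T -> nat) :
  comput f -> comput n -> comput (fun c => nth u (f c) (n c)).
Proof.
move=> fP nP; apply: (comput_eqf (f := fun c => foldr (fun x _ => x) u (drop (n c) (f c)))).
  move=> x; transitivity (nth u (drop (n x) (f x)) 0); first by case: drop.
  by rewrite nth_drop addn0.
apply: comput_foldr; comput; exact: comput_drop.
Qed.

Lemma comput_mem T (U : eqType) `{codable T} `{codable U} (f : T -> U)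
    (g : T -> seq U) :
  injective (code_of : U -> nat) ->
  comput f -> comput g -> comput (fun c => f c \in g c).
Proof.
move=> inj fP gP; apply: (comput_eqf (f := fun c => has (fun x => x == f c) (g c))).
  by move=> x; rewrite -has_pred1.
by apply: comput_has => //; apply: comput_eq => //; comput.
Qed.

(* [n %/ d] is the number of [q < n] with [q.+1 * d <= n]. *)
Lemma comput_div T `{codable T} (f g : T -> nat) :
  comput f -> comput g -> comput (fun c => f c %/ g c).
Proof.
move=> fP gP; apply: (comput_eqf (f := fun c => if g c == 0 then 0 else
  size (seq.filter (fun q => q.+1 * g c <= f c) (iota 0 (f c))))).
  move=> x; case: eqP => [->|/eqP]; first by rewrite divn0.
  rewrite -lt0n => g0; rewrite size_filter.
  rewrite (eq_count (a2 := fun q => q < f x %/ g x)); last first.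
    by move=> q /=; rewrite leq_divRL.
  have := leq_div (f x) (g x); move: (f x %/ g x) => k kf.
  rewrite -(subnKC kf) iotaD count_cat add0n.
  rewrite (@eq_in_count _ _ predT (iota 0 k)); last first.
    by move=> q /=; rewrite mem_iota.
  rewrite (@eq_in_count _ _ pred0 (iota k _)); last first.
    by move=> q /=; rewrite mem_iota => /andP[kq _]; rewrite ltnNge kq.
  by rewrite count_predT count_pred0 size_iota addn0.
comput; apply: comput_size; apply: comput_filter; last by apply: comput_iota; comput.
by comput.
Qed.

Lemma comput_mod T `{codable T} (f g : T -> nat) :
  comput f -> comput g -> comput (fun c => f c %% g c).
Proof.
move=> fP gP; apply: (comput_eqf (f := fun c => f c - f c %/ g c * g c)).
  by move=> x; rewrite {1}(divn_eq (f x) (g x)) addnC addnK.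
by comput; apply: comput_div.
Qed.

(** * The algorithm *)

Definition words (k L : nat) : seq (seq nat) :=
  iter L (fun W => flatten [seq [seq a :: w | w <- W] | a <- iota 0 k]) [:: [::]].

Definition edge (k : nat) (F : seq (seq nat)) (a b : nat) : bool :=
  [&& a < k, b < k & [:: a; b] \notin F].

Definition radius (P : seq (seq (seq nat))) : nat := sumn (flatten (flatten P)).

Definition side (P : seq (seq (seq nat))) : nat := (radius P + radius P).+1.

(* [position r (enc_int z)] is [z + r] whenever [`|z| <= r]. *)
Definition position (r z : nat) : nat :=
  if odd z then r - z./2.+1 else r + z./2.

Definition tile_at (s : nat) (q : seq nat) (x y : nat) : nat :=
  nth 0 q (y * s + x).

Definition admissible (P : seq (seq (seq nat))) (q : seq nat) : bool :=
  all (fun p => has (fun c =>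
    tile_at (side P) q (position (radius P) (nth 0 c 0)) (position (radius P) (nth 0 c 1))
      != nth 0 c 2) p) P.

Definition tiles (k : nat) (P : seq (seq (seq nat))) : seq (seq nat) :=
  [seq q <- words k (side P * side P) | admissible P q].

Definition hmatch (s : nat) (q q' : seq nat) : bool :=
  all (fun y => all (fun x => tile_at s q x.+1 y == tile_at s q' x y)
    (iota 0 (s - 1))) (iota 0 s).

Definition vmatch (s : nat) (q q' : seq nat) : bool :=
  all (fun y => all (fun x => tile_at s q x y.+1 == tile_at s q' x y)
    (iota 0 s)) (iota 0 (s - 1)).

Definition labels (s : nat) (T : seq (seq nat)) : seq (seq nat * seq nat) :=
  flatten [seq [seq (t, t') | t' <- T & hmatch s t t'] | t <- T].

Definition vmatch2 (s : nat) (l l' : seq nat * seq nat) : bool :=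
  vmatch s l.1 l'.1 && vmatch s l.2 l'.2.

Definition phase (m e g i : nat) : nat := (i + m - g * e) %% m.

Definition shown (m e g i : nat) (l : seq nat * seq nat) : seq nat :=
  if (i == 0) && (g.+1 == m %/ e) then l.1 else l.2.

Definition data_letter (m e : nat) (al be : seq nat) (g i : nat)
    (l : seq nat * seq nat) (t : seq nat) : nat :=
  nth 0 (if shown m e g i l == t then be else al) (phase m e g i).

Definition block (m e : nat) (al be : seq nat) (hdr T : seq (seq nat)) (i : nat)
    (l : seq nat * seq nat) : seq nat :=
  [seq nth 0 h i | h <- hdr] ++
  flatten [seq [seq data_letter m e al be g i l t | t <- T] | g <- iota 0 (m %/ e)].

Definition height (m e : nat) (hdr T : seq (seq nat)) : nat :=
  size hdr + m %/ e * size T.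

Definition legal (s m e : nat) (al be : seq nat) (hdr T : seq (seq nat)) :
    seq (seq nat) :=
  flatten [seq flatten [seq flatten [seq flatten [seq
    [seq take (height m e hdr T + height m e hdr T)
       (drop o (block m e al be hdr T i l1 ++
                block m e al be hdr T i l2 ++ block m e al be hdr T i l3))
    | o <- iota 0 (height m e hdr T)]
    | l3 <- labels s T & vmatch2 s l2 l3]
    | l2 <- labels s T & vmatch2 s l1 l2]
    | l1 <- labels s T]
    | i <- iota 0 m].

Definition forbidden (k s m e : nat) (al be : seq nat) (hdr T : seq (seq nat)) :
    seq (seq nat) :=
  [seq w <- words k (height m e hdr T + height m e hdr T)
  | w \notin legal s m e al be hdr T].

Definition closed_walk (k : nat) (F : seq (seq nat)) (m : nat) (u : seq nat) :
    bool :=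
  (size u == m) &&
  all (fun i => edge k F (nth 0 u i) (nth 0 u (i.+1 %% m))) (iota 0 m).

Definition good_data (k : nat) (F : seq (seq nat)) (m e : nat)
    (al be : seq nat) : bool :=
  [&& 0 < e, e.+1 < m, m %/ e * e == m, closed_walk k F m al,
    closed_walk k F m be,
    all (fun j => (j <= e) || (nth 0 al j == nth 0 be j)) (iota 0 m) &
    all (fun j => ~~ edge k F (nth 0 be j) (nth 0 al j.+1) ||
                  ~~ edge k F (nth 0 al j) (nth 0 be j.+1)) (iota 0 e)].

Definition good_header (k : nat) (F : seq (seq nat)) (m n : nat)
    (hdr : seq (seq nat)) : bool :=
  [&& 0 < size hdr, all (closed_walk k F m) hdr &
  all (fun d => all (fun i => all (fun i' =>
    ((d == 0) && (i' == i.+1 %% m)) ||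
    has (fun p => ((p + d) %% n < size hdr) &&
      ~~ edge k F (nth 0 (nth [::] hdr p) i)
                  (nth 0 (nth [::] hdr ((p + d) %% n)) i'))
      (iota 0 (size hdr)))
    (iota 0 m)) (iota 0 m)) (iota 0 n)].

Definition input : Type := nat * nat * seq (seq nat) * seq (seq (seq nat)).

Definition cert_m (c : seq (seq nat)) : nat := nth 0 (nth [::] c 0) 0.
Definition cert_e (c : seq (seq nat)) : nat := nth 0 (nth [::] c 0) 1.
Definition cert_al (c : seq (seq nat)) : seq nat := nth [::] c 1.
Definition cert_be (c : seq (seq nat)) : seq nat := nth [::] c 2.
Definition cert_hdr (c : seq (seq nat)) : seq (seq nat) := drop 3 c.

Definition cert_n (x : input) (c : seq (seq nat)) : nat :=
  height (cert_m c) (cert_e c) (cert_hdr c) (tiles x.1.1.2 x.2).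

Definition good_cert (x : input) (c : seq (seq nat)) : bool :=
  good_data x.1.1.1 x.1.2 (cert_m c) (cert_e c) (cert_al c) (cert_be c) &&
  good_header x.1.1.1 x.1.2 (cert_m c) (cert_n x c) (cert_hdr c).

Definition cert_forbidden (x : input) (c : seq (seq nat)) : seq (seq nat) :=
  forbidden x.1.1.1 (side x.2) (cert_m c) (cert_e c) (cert_al c) (cert_be c)
    (cert_hdr c) (tiles x.1.1.2 x.2).

Definition cert_output (x : input) (c : seq (seq nat)) : seq nat :=
  [:: cert_m c; cert_n x c; code_of (cert_forbidden x c)].

Ltac comput_lib ::=
  lazymatch goal with
  | |- comput (fun c => iter (@?n c) (@?F c) (@?z c)) =>
      refine (comput_iter (n := n) (F := F) (z := z) _ _ _)
  | |- comput (fun c => foldr (@?F c) (@?z c) (@?l c)) =>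
      refine (comput_foldr (F := F) (z := z) (l := l) _ _ _)
  | |- comput (fun c => map (@?F c) (@?l c)) =>
      refine (comput_map (F := F) (l := l) _ _)
  | |- comput (fun c => seq.filter (@?P c) (@?l c)) =>
      refine (comput_filter (P := P) (l := l) _ _)
  | |- comput (fun c => all (@?P c) (@?l c)) =>
      refine (comput_all (P := P) (l := l) _ _)
  | |- comput (fun c => has (@?P c) (@?l c)) =>
      refine (comput_has (P := P) (l := l) _ _)
  | |- comput (fun c => cat (@?f c) (@?g c)) =>
      refine (comput_cat (f := f) (g := g) _ _)
  | |- comput (fun c => flatten (@?f c)) => refine (comput_flatten (f := f) _)
  | |- comput (fun c => size (@?f c)) => refine (comput_size (f := f) _)
  | |- comput (fun c => sumn (@?f c)) => refine (comput_sumn (f := f) _)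
  | |- comput (fun c => iota (@?m c) (@?n c)) =>
      refine (comput_iota (m := m) (n := n) _ _)
  | |- comput (fun c => drop (@?n c) (@?f c)) =>
      refine (comput_drop (n := n) (f := f) _ _)
  | |- comput (fun c => take (@?n c) (@?f c)) =>
      refine (comput_take (n := n) (f := f) _ _)
  | |- comput (fun c => nth ?u (@?f c) (@?n c)) =>
      refine (comput_nth u (n := n) (f := f) _ _)
  | |- comput (fun c => in_mem (@?f c) (mem (@?g c))) =>
      refine (comput_mem (f := f) (g := g) _ _ _);
        [by repeat apply: code_of_seq_inj | |]
  | |- comput (fun c => divn (@?f c) (@?g c)) =>
      refine (comput_div (f := f) (g := g) _ _)
  | |- comput (fun c => modn (@?f c) (@?g c)) =>
      refine (comput_mod (f := f) (g := g) _ _)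
  end.

Lemma comput_words T `{codable T} (k L : T -> nat) :
  comput k -> comput L -> comput (fun c => words (k c) (L c)).
Proof. by move=> *; rewrite /words; comput. Qed.

Lemma comput_edge T `{codable T} k F a b :
  comput k -> comput F -> comput a -> comput b ->
  comput (fun c : T => edge (k c) (F c) (a c) (b c)).
Proof. by move=> *; rewrite /edge; comput. Qed.

Ltac comput_algo := fail.
Ltac comput_all_steps := repeat (cbv beta; first [comput_algo | comput_step]).

Lemma comput_radius T `{codable T} P :
  comput P -> comput (fun c : T => radius (P c)).
Proof. by move=> *; rewrite /radius; comput. Qed.

Lemma comput_position T `{codable T} r z :
  comput r -> comput z -> comput (fun c : T => position (r c) (z c)).
Proof. by move=> *; rewrite /position; comput. Qed.

Lemma comput_tile_at T `{codable T} s q x y :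
  comput s -> comput q -> comput x -> comput y ->
  comput (fun c : T => tile_at (s c) (q c) (x c) (y c)).
Proof. by move=> *; rewrite /tile_at; comput. Qed.

Ltac comput_algo ::= first
  [ simple apply comput_words | simple apply comput_edge
  | simple apply comput_radius | simple apply comput_position
  | simple apply comput_tile_at ].

Lemma comput_side T `{codable T} P : comput P -> comput (fun c : T => side (P c)).
Proof. by move=> *; rewrite /side; comput_all_steps. Qed.

Lemma comput_hmatch T `{codable T} s q q' :
  comput s -> comput q -> comput q' ->
  comput (fun c : T => hmatch (s c) (q c) (q' c)).
Proof. by move=> *; rewrite /hmatch; comput_all_steps. Qed.

Lemma comput_vmatch T `{codable T} s q q' :
  comput s -> comput q -> comput q' ->
  comput (fun c : T => vmatch (s c) (q c) (q' c)).
Proof. by move=> *; rewrite /vmatch; comput_all_steps. Qed.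

Ltac comput_algo ::= first
  [ simple apply comput_words | simple apply comput_edge
  | simple apply comput_radius | simple apply comput_position
  | simple apply comput_tile_at | simple apply comput_side
  | simple apply comput_hmatch | simple apply comput_vmatch ].

Lemma comput_tiles T `{codable T} k P :
  comput k -> comput P -> comput (fun c : T => tiles (k c) (P c)).
Proof. by move=> *; rewrite /tiles /admissible; comput_all_steps. Qed.

Lemma comput_labels T `{codable T} s Q :
  comput s -> comput Q -> comput (fun c : T => labels (s c) (Q c)).
Proof. by move=> *; rewrite /labels; comput_all_steps. Qed.

Lemma comput_vmatch2 T `{codable T} s l l' :
  comput s -> comput l -> comput l' ->
  comput (fun c : T => vmatch2 (s c) (l c) (l' c)).
Proof. by move=> *; rewrite /vmatch2; comput_all_steps. Qed.

Lemma comput_height T `{codable T} m e hdr Q :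
  comput m -> comput e -> comput hdr -> comput Q ->
  comput (fun c : T => height (m c) (e c) (hdr c) (Q c)).
Proof. by move=> *; rewrite /height; comput_all_steps. Qed.

Lemma comput_block T `{codable T} m e al be hdr Q i l :
  comput m -> comput e -> comput al -> comput be -> comput hdr -> comput Q ->
  comput i -> comput l ->
  comput (fun c : T => block (m c) (e c) (al c) (be c) (hdr c) (Q c) (i c) (l c)).
Proof.
move=> *; rewrite /block /data_letter /phase /shown.
comput_all_steps.
Qed.

Lemma comput_closed_walk T `{codable T} k F m u :
  comput k -> comput F -> comput m -> comput u ->
  comput (fun c : T => closed_walk (k c) (F c) (m c) (u c)).
Proof. by move=> *; rewrite /closed_walk; comput_all_steps. Qed.

Ltac comput_algo ::= first
  [ simple apply comput_words | simple apply comput_edge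
  | simple apply comput_side | simple apply comput_labels
  | simple apply comput_vmatch2 | simple apply comput_height
  | simple apply comput_block | simple apply comput_closed_walk
  | simple apply comput_tiles ].

Lemma comput_good_data T `{codable T} k F m e al be :
  comput k -> comput F -> comput m -> comput e -> comput al -> comput be ->
  comput (fun c : T => good_data (k c) (F c) (m c) (e c) (al c) (be c)).
Proof. by move=> *; rewrite /good_data; comput_all_steps. Qed.

Lemma comput_good_header T `{codable T} k F m n hdr :
  comput k -> comput F -> comput m -> comput n -> comput hdr ->
  comput (fun c : T => good_header (k c) (F c) (m c) (n c) (hdr c)).
Proof. by move=> *; rewrite /good_header; comput_all_steps. Qed.

Lemma comput_legal T `{codable T} s m e al be hdr Q :
  comput s -> comput m -> comput e -> comput al -> comput be -> comput hdr ->
  comput Q -> comput (fun c : T => legal (s c) (m c) (e c) (al c) (be c) (hdr c) (Q c)).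
Proof. by move=> *; rewrite /legal; comput_all_steps. Qed.

Lemma comput_good_cert : comput (fun p : input * seq (seq nat) => good_cert p.1 p.2).
Proof.
rewrite /good_cert /cert_n /cert_m /cert_e /cert_al /cert_be /cert_hdr /input.
apply: comput_and.
  by apply: comput_good_data; comput_all_steps.
by apply: comput_good_header; comput_all_steps.
Qed.

Lemma comput_code_of T U `{codable T} `{codable U} (f : T -> U) :
  comput f -> comput (fun c => code_of (f c)).
Proof. by case=> g gP gE; exists g. Qed.

Lemma comput_cert_output :
  comput (fun p : input * seq (seq nat) => cert_output p.1 p.2).
Proof.
rewrite /cert_output /cert_n /cert_forbidden /cert_m /cert_e /cert_al /cert_be.
rewrite /cert_hdr /input.
apply: comput_cons; first by comput_all_steps.
apply: comput_cons; first by comput_all_steps.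
apply: comput_cons; last by comput_all_steps.
apply: comput_code_of; rewrite /forbidden; comput_all_steps.
by apply: comput_legal; comput_all_steps.
Qed.

Lemma computes_search k chk out : prim k.+1 chk -> prim k.+1 out ->
  exists algo : murec k, forall (v : k.-tuple nat) y, chk (y :: v) = 0 ->
    exists2 y', chk (y' :: v) = 0 & computes algo v (out (y' :: v)).
Proof.
move=> [c cP] [o oP].
exists (MComp o (fun i : 'I_k.+1 => if unlift ord0 i is Some j then MProj j
  else MMin c)) => v y chky.
have [y' /eqP chky' ymin] := @ex_minnP (fun y => chk (y :: v) == 0)
  (ex_intro _ y (introT eqP chky)).
exists y' => //=; exists [tuple of y' :: v]; last exact: (oP [tuple of y' :: v]).
move=> i; case: unliftP => [j ->|->] /=.
  by rewrite !(tnth_nth 0).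
rewrite (tnth_nth 0) /=; split=> [|j jy].
  by rewrite -[X in computes _ _ X]chky'; apply: (cP [tuple of y' :: v]).
case E : (chk (j :: v)) => [|z].
  by have := ymin _ (introT eqP E); rewrite leqNgt jy.
by exists z; rewrite -E; apply: (cP [tuple of j :: v]).
Qed.

Definition input_code (v : seq nat) : nat :=
  CodeSeq.code [:: CodeSeq.code [:: CodeSeq.code [:: nth 0 v 0; nth 0 v 1];
    nth 0 v 2]; nth 0 v 3].

Lemma algo_search : exists algo : murec 4, forall (x : input) (v : 4.-tuple nat) c,
  input_code v = code_of x -> good_cert x c ->
  exists2 c', good_cert x c' & computes algo v (code_of (cert_output x c')).
Proof.
have [g gP gE] := comput_good_cert; have [h hP hE] := comput_cert_output.
pose pk (v : seq nat) := CodeSeq.code [:: input_code (behead v); nth 0 v 0].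
have prP f f' : prim 5 f -> prim 5 f' ->
    prim 5 (fun v => CodeSeq.code [:: f v; f' v]).
  move=> fP f'P; apply: prim_code_cons => //.
  by apply: (@prim_code_cons 5 _ (fun=> 0)) => //; apply: prim_const.
have pkP : prim 5 pk.
  apply: (prP); last exact: prim_nth.
  have nP i : i < 4 -> prim 5 (fun v => nth 0 (behead v) i).
    move=> i4; apply: prim_eq (@prim_nth 5 i.+1 i4) => v _.
    by rewrite nth_behead.
  by do 3!(apply: (prP); last exact: nP); exact: nP.
have [algo algoP] := computes_search
  (chk := fun v => 1 - g (pk v)) (out := fun v => h (pk v))
  (prim_sub (prim_const _ 1) (prim_comp1 gP pkP)) (prim_comp1 hP pkP).
exists algo => x v c vx xc.
have pkE y (d : seq (seq nat)) : y = code_of d -> pk (y :: v) = code_of (x, d).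
  by move=> ->; rewrite /pk /= vx.
have dE (y : nat) : y = code_of (map CodeSeq.decode (CodeSeq.decode y)).
  rewrite /code_of /codable_seq -map_comp (eq_map (g := id)); last first.
    by move=> s /=; rewrite /code_of /codable_nat map_id CodeSeq.decodeK.
  by rewrite map_id CodeSeq.decodeK.
have h0 : 1 - g (pk (code_of c :: v)) = 0 by rewrite (pkE _ c) // gE xc.
have [y chky yc] := algoP _ _ h0.
exists (map CodeSeq.decode (CodeSeq.decode y)); last first.
  by rewrite -(hE (x, _)) -(pkE _ _ (dE y)).
by move: chky; rewrite (pkE _ _ (dE y)) gE; case: good_cert.
Qed.

(** * Configurations made of blocks *)

Lemma nth_flatten_uniform (U : Type) (u : U) (ss : seq (seq U)) w g r :
  all (fun s => size s == w) ss -> g < size ss -> r < w ->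
  nth u (flatten ss) (g * w + r) = nth u (nth [::] ss g) r.
Proof.
elim: ss g => [|s ss IH] g //= /andP[/eqP sw ssw]; case: g => [|g].
  by move=> _ rw; rewrite nth_cat add0n sw rw.
rewrite ltnS => gs rw; rewrite nth_cat sw mulSn -addnA ltnNge leq_addr /=.
by rewrite addKn IH.
Qed.

Lemma mem_words k L w : (w \in words k L) = (size w == L) && all (fun a => a < k) w.
Proof.
elim: L w => [|L IH] w; first by case: w.
rewrite /words iterS -/(words k L); apply/flatten_mapP/idP => [[a + /mapP[v + ->]]|].
  by rewrite mem_iota add0n IH /= eqSS => -> /andP[-> ->].
case: w => // a w /=; rewrite eqSS => /andP[sw /andP[ak wk]].
by exists a; [rewrite mem_iota | apply: map_f; rewrite IH sw].
Qed.

Lemma mem_labels s T l :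
  (l \in labels s T) = [&& l.1 \in T, l.2 \in T & hmatch s l.1 l.2].
Proof.
apply/flatten_mapP/and3P => [[t tT /mapP[t' + ->]]|[l1T l2T l12]].
  by rewrite mem_filter => /andP[-> ->].
exists l.1 => //; apply/mapP; exists l.2; last by case: (l).
by rewrite mem_filter l12.
Qed.

Definition quo (d : nat) (z : int) : int := (z %/ Posz d)%Z.
Definition res (d : nat) (z : int) : nat := `|(z %% Posz d)%Z|%N.

Section QuoRes.
Variable d : nat.
Hypothesis d0 : 0 < d.

Lemma res_lt z : res d z < d.
Proof.
rewrite /res; have := ltz_mod z (d := Posz d); have := modz_ge0 z (d := Posz d).
by move=> /(_ _)/[!eqz_nat]; lia.
Qed.

Lemma quo_res z : z = (quo d z * d%:Z + (res d z)%:Z)%R.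
Proof.
rewrite {1}(divz_eq z d) /quo /res; congr (_ + _)%R.
by rewrite gez0_abs // modz_ge0 // eqz_nat; lia.
Qed.

Lemma quo_res_eq (I : int) i : i < d ->
  quo d (I * d%:Z + i%:Z)%R = I /\ res d (I * d%:Z + i%:Z)%R = i.
Proof.
move=> id; rewrite /quo /res.
have dn : Posz d != 0%R by rewrite eqz_nat; lia.
rewrite divzMDl // modzMDl divz_small ?modz_small ?addr0 //=; lia.
Qed.

Lemma resD (z J : int) : res d (z + J * d%:Z)%R = res d z.
Proof. by rewrite /res addrC modzMDl. Qed.

Lemma res_succ z : res d (z + 1)%R = (res d z).+1 %% d.
Proof.
have rd := res_lt z; rewrite [in LHS](quo_res z) -addrA.
have [r1|r1] := eqVneq (res d z).+1 d.
  have -> : (quo d z * d%:Z + ((res d z)%:Z + 1) = 0%:Z + (quo d z + 1) * d%:Z)%R.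
    by rewrite mulrDl mul1r; lia.
  by rewrite resD r1 modnn /res mod0z.
have r2 : (res d z).+1 < d by lia.
by have [_] := quo_res_eq (quo d z) r2; rewrite modn_small // => <-; congr res; lia.
Qed.

Lemma succ_mod_inj i j : i < d -> j < d -> i.+1 %% d = j.+1 %% d -> i = j.
Proof.
move=> id jd; have [i1|i1] := eqVneq i.+1 d; have [j1|j1] := eqVneq j.+1 d;
  rewrite ?i1 ?j1 ?modnn ?modn_small; lia.
Qed.
End QuoRes.

Lemma int_step_ind (P : int -> Prop) :
  P 0%R -> (forall z, P z <-> P (z + 1)%R) -> forall z, P z.
Proof.
move=> P0 PS; elim/int_ind => [//|j|j].
  by move=> /PS; rewrite -PoszD addn1.
by move=> Pj; apply/PS; have -> : (- j.+1%:Z + 1 = - j%:Z)%R by lia.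
Qed.

Section Blocks.
Variables (k : nat) (F : seq (seq nat)) (s m e : nat) (al be : seq nat).
Variables (hdr T : seq (seq nat)).
Hypothesis data_ok : good_data k F m e al be.
Let n := height m e hdr T.
Hypothesis hdr_ok : good_header k F m n hdr.

Local Notation E := (edge k F).
Local Notation blk := (block m e al be hdr T).
Let hd p i := nth 0 (nth [::] hdr p) i.

Lemma e_gt0 : 0 < e. Proof. by case/and5P: data_ok. Qed.
Lemma e_lt : e.+1 < m. Proof. by case/and5P: data_ok. Qed.
Lemma divmeK : m %/ e * e = m. Proof. by case/and5P: data_ok => _ _ /eqP. Qed.
Lemma divme_gt1 : 1 < m %/ e.
Proof. by have := divmeK; have := e_lt; case: (m %/ e) => [|[|]] //; lia. Qed.

Lemma walk_al i : i < m -> E (nth 0 al i) (nth 0 al (i.+1 %% m)).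
Proof.
case/and5P: data_ok => _ _ _ /andP[_ /allP H] _ im.
by apply: H; rewrite mem_iota.
Qed.

Lemma walk_be i : i < m -> E (nth 0 be i) (nth 0 be (i.+1 %% m)).
Proof.
case/and5P: data_ok => _ _ _ _ /and3P[/andP[_ /allP H] _ _] im.
by apply: H; rewrite mem_iota.
Qed.

Lemma al_be i : e < i -> i < m -> nth 0 al i = nth 0 be i.
Proof.
case/and5P: data_ok => _ _ _ _ /and3P[_ /allP H _] ei im.
by have := H i; rewrite mem_iota im => /(_ isT)/orP[ie|/eqP //]; lia.
Qed.

Lemma coupled j : j < e ->
  ~~ E (nth 0 be j) (nth 0 al j.+1) || ~~ E (nth 0 al j) (nth 0 be j.+1).
Proof.
case/and5P: data_ok => _ _ _ _ /and3P[_ _ /allP H] je.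
by apply: H; rewrite mem_iota.
Qed.

Lemma hdr_gt0 : 0 < size hdr. Proof. by case/and3P: hdr_ok. Qed.

Lemma height_gt0 : 0 < n. Proof. by rewrite ltn_addr ?hdr_gt0. Qed.

Lemma walk_hdr p i : p < size hdr -> i < m -> E (hd p i) (hd p (i.+1 %% m)).
Proof.
case/and3P: hdr_ok => _ /(all_nthP [::]) H _ pl im.
by have /andP[_ /allP{}H] := H p pl; apply: H; rewrite mem_iota.
Qed.

Lemma hdr_sync d i i' : d < n -> i < m -> i' < m ->
  (d = 0 /\ i' = i.+1 %% m) \/
  exists p, [/\ p < size hdr, (p + d) %% n < size hdr &
                ~~ E (hd p i) (hd ((p + d) %% n) i')].
Proof.
case/and3P: hdr_ok => _ _ /allP H dn im i'm.
have := H d; rewrite mem_iota => /(_ dn)/allP{}H.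
have := H i; rewrite mem_iota => /(_ im)/allP{}H.
have := H i'; rewrite mem_iota => /(_ i'm)/orP[/andP[/eqP -> /eqP ->]|]; first by left.
by case/hasP => p; rewrite mem_iota => pl /andP[pdl nE]; right; exists p.
Qed.

Lemma size_rows (f : nat -> seq nat -> nat) :
  size (flatten [seq [seq f g t | t <- T] | g <- iota 0 (m %/ e)]) = m %/ e * size T.
Proof.
rewrite size_flatten /shape -map_comp (eq_map (g := fun=> size T)); last first.
  by move=> g /=; rewrite size_map.
rewrite -[in RHS](size_iota 0 (m %/ e)).
by elim: (iota 0 _) => //= g r ->; rewrite mulSn.
Qed.

Lemma size_block i l : size (blk i l) = n.
Proof. by rewrite size_cat size_map size_rows. Qed.

Lemma nth_block_hdr i l p : p < size hdr -> nth 0 (blk i l) p = hd p i.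
Proof. by move=> pl; rewrite nth_cat size_map pl (nth_map [::]). Qed.

Lemma nth_block_data i l g r : g < m %/ e -> r < size T ->
  nth 0 (blk i l) (size hdr + (g * size T + r)) =
  data_letter m e al be g i l (nth [::] T r).
Proof.
move=> gm rT; rewrite nth_cat size_map ltnNge leq_addr /= addKn.
rewrite nth_flatten_uniform ?size_map ?size_iota //; last first.
  by apply/allP => u /mapP[g' _ ->]; rewrite size_map.
by rewrite (nth_map 0) ?size_iota // (nth_map [::]) // nth_iota.
Qed.

Lemma block_rowP q : q < n -> q < size hdr \/
  exists g r, [/\ g < m %/ e, r < size T & q = size hdr + (g * size T + r)].
Proof.
move=> qn; have [ql|lq] := ltnP q (size hdr); [by left | right].
have qd : q - size hdr < m %/ e * size T by rewrite -/n in qn; rewrite ltn_subLR.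
have T0 : 0 < size T by case: (size T) qd => //; rewrite muln0.
exists ((q - size hdr) %/ size T), ((q - size hdr) %% size T).
split; rewrite ?ltn_mod ?ltn_divLR // -divn_eq.
by rewrite subnKC.
Qed.

Lemma ge_lt g : g < m %/ e -> g.+1 * e <= m.
Proof. by move=> gm; rewrite -[leqRHS]divmeK leq_mul2r gm orbT. Qed.

Lemma phaseE g i : g < m %/ e -> i < m ->
  phase m e g i = if g * e <= i then i - g * e else i + m - g * e.
Proof.
move=> gm im; have gem := ge_lt gm; have e0 := e_gt0; rewrite /phase.
case: leqP => h; last by rewrite modn_small; lia.
have -> : i + m - g * e = m + (i - g * e) by lia.
by rewrite modnDl modn_small; lia.
Qed.

(* The rows of group [i %/ e] are in their coupled segment between columns [i]
   and [i.+1], so they carry the tile from one column to the next. *)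
Lemma block_couple i l l' : i < m ->
  l.2 \in T -> (if i.+1 == m then l'.1 else l'.2) \in T ->
  (forall q, q < n -> E (nth 0 (blk i l) q) (nth 0 (blk (i.+1 %% m) l') q)) ->
  l.2 = if i.+1 == m then l'.1 else l'.2.
Proof.
move=> im aT bT H; have e0 := e_gt0; have elt := e_lt; have k1 := divme_gt1.
set b := (X in _ = X) in bT *.
have gm : i %/ e < m %/ e by rewrite ltn_divLR // divmeK.
have je : i %% e < e by rewrite ltn_mod.
have iE := divn_eq i e; set g := i %/ e in gm iE *; set j := i %% e in je iE *.
have ph : phase m e g i = j by rewrite phaseE //; case: leqP; lia.
have ph' : phase m e g (i.+1 %% m) = j.+1.
  have [im1|im1] := eqVneq i.+1 m.
    by rewrite im1 modnn phaseE; [case: leqP; lia|lia|lia].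
  rewrite modn_small; last by lia.
  by rewrite phaseE; [case: leqP; lia|lia|lia].
have sh : shown m e g i l = l.2.
  rewrite /shown; case: eqP => //= i0; case: eqP => // g1.
  by move: k1; rewrite -g1 /g i0 div0n.
have sh' : shown m e g (i.+1 %% m) l' = b.
  rewrite /shown /b; have [im1|im1] := eqVneq i.+1 m.
    rewrite im1 modnn eqxx /=; case: eqP => // /eqP g1.
    have : g.+2 * e <= m by apply: ge_lt; rewrite ltn_neqAle g1.
    by rewrite !mulSn; lia.
  by rewrite modn_small ?eqn0 //=; lia.
apply/eqP; apply: contraT => ab.
have rowE t : t \in T -> E (nth 0 (if l.2 == t then be else al) j)
                            (nth 0 (if b == t then be else al) j.+1).
  move=> tT; have rT : index t T < size T by rewrite index_mem.
  have := H (size hdr + (g * size T + index t T)).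
  rewrite !nth_block_data // /data_letter sh sh' ph ph' nth_index //; apply.
  rewrite ltn_add2l; apply: (@leq_trans (g.+1 * size T)).
    by rewrite mulSn addnC ltn_add2r.
  by rewrite leq_mul2r gm orbT.
have := coupled je; have := rowE _ aT; have := rowE _ bT.
by rewrite !eqxx (negbTE ab) [b == _]eq_sym (negbTE ab) => -> ->.
Qed.

Lemma block_cons i t0 t0' t : i != 0 -> blk i (t0, t) = blk i (t0', t).
Proof.
by move=> i0; rewrite /block /data_letter /shown (negbTE i0).
Qed.

Lemma block_walk i t0 t t' q : i < m -> q < n ->
  E (nth 0 (blk i (t0, t)) q)
    (nth 0 (blk (i.+1 %% m) (if i.+1 == m then (t, t') else (t0, t))) q).
Proof.
move=> im qn; have e0 := e_gt0; have elt := e_lt; have k1 := divme_gt1.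
have [ql|[g [r [gm rT ->]]]] := block_rowP qn.
  by rewrite !nth_block_hdr //; apply: walk_hdr.
rewrite !nth_block_data //; set u := nth _ T r; rewrite /data_letter.
have gem := ge_lt gm; rewrite mulSn in gem.
set j := phase m e g i; have jm : j < m by rewrite ltn_mod; lia.
have -> : phase m e g (i.+1 %% m) = j.+1 %% m.
  rewrite /j [phase _ _ _ i]phaseE //.
  have [im1|im1] := eqVneq i.+1 m.
    rewrite im1 modnn phaseE //; last by lia.
    case: (leqP (g * e) i) => h; last by lia.
    case: leqP => h'; last by rewrite modn_small; lia.
    by have -> : (i - g * e).+1 = m by [lia]; rewrite modnn; lia.
  have im2 : i.+1 < m by lia.
  rewrite (modn_small im2) phaseE //.
  case: (leqP (g * e) i) => h; case: leqP => h'; try by rewrite modn_small; lia.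
  by have -> : (i + m - g * e).+1 = m by [lia]; rewrite modnn; lia.
have same (a b : bool) : a = b \/ nth 0 al j = nth 0 be j \/
    nth 0 al (j.+1 %% m) = nth 0 be (j.+1 %% m) ->
    E (nth 0 (if a then be else al) j) (nth 0 (if b then be else al) (j.+1 %% m)).
  have := walk_al jm; have := walk_be jm.
  by case: a b => -[] ? ? [|[]] // => [<-|->|->|<-].
apply: same; rewrite /shown.
have [im1|im1] := eqVneq i.+1 m; last first.
  rewrite modn_small /=; last by lia.
  have [i0|i0] := eqVneq i 0; last by left.
  have [gl|gl] := eqVneq g.+1 (m %/ e); last by left.
  right; right.
  have gE : g * e + e = m by rewrite -[RHS]divmeK -gl mulSn addnC.
  have jE : j = e by rewrite /j phaseE // i0; case: leqP; lia.
  by rewrite jE modn_small // al_be.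
rewrite im1 modnn /=; have -> : (i == 0) = false by apply/eqP; lia.
have [gl|gl] := eqVneq g.+1 (m %/ e); first by left.
right.
have g2 : g.+2 * e <= m by apply: ge_lt; rewrite ltn_neqAle gl.
have jE : j = m.-1 - g * e by rewrite /j phaseE //; case: leqP; lia.
have [g0|g0] := posnP g.
  by left; rewrite al_be // jE g0 mul0n; lia.
have g1e : e <= g * e by rewrite leq_pmull.
by right; rewrite !mulSn in g2; rewrite modn_small ?al_be // jE; lia.
Qed.

Lemma mem_legal w : w \in legal s m e al be hdr T <->
  exists i l1 l2 l3 o, [/\ [/\ i < m, l1 \in labels s T, l2 \in labels s T &
    l3 \in labels s T], vmatch2 s l1 l2, vmatch2 s l2 l3, o < n &
    w = take (n + n) (drop o (blk i l1 ++ blk i l2 ++ blk i l3))].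
Proof.
split=> [/flatten_mapP[i]|[i [l1 [l2 [l3 [o [[im T1 T2 T3] v12 v23 on ->]]]]]]].
  rewrite mem_iota => im /flatten_mapP[l1 T1] /flatten_mapP[l2].
  rewrite mem_filter => /andP[v12 T2] /flatten_mapP[l3].
  rewrite mem_filter => /andP[v23 T3] /mapP[o]; rewrite mem_iota => on ->.
  by exists i, l1, l2, l3, o.
apply/flatten_mapP; exists i; first by rewrite mem_iota.
apply/flatten_mapP; exists l1 => //.
apply/flatten_mapP; exists l2; first by rewrite mem_filter v12.
apply/flatten_mapP; exists l3; first by rewrite mem_filter v23.
by apply/mapP; exists o; rewrite ?mem_iota.
Qed.

Definition hedges (x : int -> int -> nat) : Prop :=
  forall c y, E (x c y) (x (c + 1)%R y).

Definition vlegal (x : int -> int -> nat) : Prop :=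
  forall c y, mkseq (fun q => x c (y + q%:Z)%R) (n + n) \in legal s m e al be hdr T.

Definition header_on (f : int -> nat) (y : int) (i : nat) (O : int) : Prop :=
  forall (z J : int) p, (y <= z)%R -> (z < y + n%:Z)%R -> z = (O + J * n%:Z + p%:Z)%R ->
    p < size hdr -> f z = hd p i.

Lemma header_sync f g y i i' O O' :
  (forall z, E (f z) (g z)) -> i < m -> i' < m ->
  header_on f y i O -> header_on g y i' O' ->
  (exists J : int, O' = O + J * n%:Z)%R /\ i' = i.+1 %% m.
Proof.
move=> fgE im i'm Hf Hg; have n0 := height_gt0.
have dO := quo_res n0 (O - O')%R; set d := res n _ in dO; set Q' := quo n _ in dO.
have [[d0 ->]|[p [pl pdl]]] := hdr_sync (res_lt n0 (O - O')%R) im i'm.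
  by split=> //; exists (- Q')%R; rewrite mulNr; rewrite /d d0 in dO; lia.
have zE := quo_res n0 (O + p%:Z - y)%R.
set r := res n _ in zE; set Q := quo n _ in zE.
have rn : r < n by apply: res_lt.
rewrite -(Hf (y + r%:Z)%R (- Q)%R p) //; [|lia|lia|by rewrite mulNr; lia].
rewrite -/d -(Hg (y + r%:Z)%R (Q' - Q + ((p + d) %/ n)%:Z)%R ((p + d) %% n)) //;
  [by rewrite fgE|lia|lia|].
rewrite !mulrDl mulNr -PoszM; have := divn_eq (p + d) n; lia.
Qed.

Definition parse (f : int -> nat) (y : int) (i : nat) (O : int)
    (l1 l2 l3 : seq nat * seq nat) : Prop :=
  [/\ [/\ i < m, l1 \in labels s T, l2 \in labels s T & l3 \in labels s T],
      vmatch2 s l1 l2, (O <= y)%R, (y < O + n%:Z)%R &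
      forall j p, j < 3 -> p < n -> let z := (O + j%:Z * n%:Z + p%:Z)%R in
        (y <= z)%R -> (z < y + (n + n)%:Z)%R ->
        f z = nth 0 (blk i (nth l1 [:: l1; l2; l3] j)) p].

Lemma parse_exists x c y : vlegal x ->
  exists i O l1 l2 l3, parse (x c) y i O l1 l2 l3.
Proof.
move=> /(_ c y)/mem_legal[i [l1 [l2 [l3 [o [lab v12 _ on wE]]]]]].
exists i, (y - o%:Z)%R, l1, l2, l3; split=> //; try lia.
move=> j p j3 pn z yz zy.
have zE : z = (y + (j * n + p - o)%:Z)%R.
  by rewrite /z; move: yz; rewrite /z -PoszM; lia.
have qn : j * n + p - o < n + n by move: zy; rewrite zE; lia.
have oq : o <= j * n + p by move: yz; rewrite /z -PoszM; lia.
have := congr1 (fun w => nth 0 w (j * n + p - o)) wE.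
rewrite nth_mkseq // zE => ->; rewrite nth_take // nth_drop subnKC //.
have -> : blk i l1 ++ blk i l2 ++ blk i l3 =
    flatten [seq blk i l | l <- [:: l1; l2; l3]] by rewrite /= cats0.
rewrite nth_flatten_uniform ?size_map //; last first.
  by rewrite /= !size_block eqxx.
by rewrite (nth_map l1).
Qed.

Lemma parse_header f y y' i O l1 l2 l3 : parse f y i O l1 l2 l3 ->
  (y <= y')%R -> (y' <= y + 1)%R -> header_on f y' i O.
Proof.
move=> [_ _ Oy yO fE] yy' y'y z J p y'z zy' zE pl; have n0 := height_gt0.
have pn : p < n by rewrite (leq_trans pl) // leq_addr.
have [J0 J3] : (0 <= J)%R /\ (J < 3)%R by split; nia.
case: J J0 J3 zE => // j _ j3 zE.
rewrite zE fE // -?zE; [|lia..].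
exact: nth_block_hdr.
Qed.

Definition frame (x : int -> int -> nat) (O i0 : int) : Prop :=
  forall (c z J : int) p, z = (O + J * n%:Z + p%:Z)%R -> p < size hdr ->
    x c z = hd p (res m (i0 + c)%R).

Lemma m_gt0 : 0 < m. Proof. by have := e_lt; lia. Qed.

Lemma frame_exists x : hedges x -> vlegal x ->
  exists O i0 : nat, [/\ O < n, i0 < m & frame x O i0].
Proof.
move=> hx vx; have n0 := height_gt0; have m0 := m_gt0.
have /choice[po poP] (cy : int * int) : exists iO : nat * int, [/\ iO.1 < m,
    header_on (x cy.1) cy.2 iO.1 iO.2 & header_on (x cy.1) (cy.2 + 1)%R iO.1 iO.2].
  have [i [O [l1 [l2 [l3 xP]]]]] := parse_exists cy.1 cy.2 vx.
  by exists (i, O); split; [case: xP => -[] | apply: (parse_header xP); lia..].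
pose pi c y := (po (c, y)).1; pose r c y := res n (po (c, y)).2.
have piP c y : pi c y < m by have [] := poP (c, y).
have step (c y : int) : [/\ r (c + 1)%R y = r c y, r (c + 1)%R (y + 1)%R = r c y,
    pi (c + 1)%R y = (pi c y).+1 %% m & pi (c + 1)%R (y + 1)%R = (pi c y).+1 %% m].
  have [im H1 H2] := poP (c, y).
  have [im' H1' _] := poP ((c + 1)%R, y).
  have [im'' H1'' _] := poP ((c + 1)%R, (y + 1)%R).
  have [[J JE] iE] := header_sync (hx c) im im' H1 H1'.
  have [[J' JE'] iE'] := header_sync (hx c) im im'' H2 H1''.
  by split=> //; rewrite /r ?JE ?JE' resD.
have ry c y : r c y = r c 0%R.
  elim/int_step_ind: y => // y; have [] := step (c - 1)%R y.
  by rewrite subrK => -> -> _ _.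
have rc c y : r c y = r 0%R 0%R.
  rewrite ry; elim/int_step_ind: c => // c; have [-> _ _ _] := step c 0%R.
  by [].
have piy c y : pi c y = pi c 0%R.
  elim/int_step_ind: y => // y; have [] := step (c - 1)%R y.
  by rewrite subrK => _ _ -> ->.
have pic c : pi c 0%R = res m ((pi 0%R 0%R)%:Z + c)%R.
  elim/int_step_ind: c => [|c].
    by have [_] := quo_res_eq m0 0%R (piP 0%R 0%R); rewrite mul0r add0r addr0.
  have [_ _ -> _] := step c 0%R; rewrite addrA res_succ //; split=> [->//|].
  by apply: succ_mod_inj => //; apply: res_lt.
exists (r 0%R 0%R), (pi 0%R 0%R); split=> //; first exact: res_lt.
move=> c z J p zE pl; rewrite -pic -(piy c z).
have [_ H _] := poP (c, z).
apply: (H z (J - quo n (po (c, z)).2)%R p) => //; first by rewrite /=; lia.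
rewrite [X in (X + _ + _)%R](quo_res n0) -/(r c z) rc mulrBl; lia.
Qed.

Lemma frame_pin x O i0 c y i' O' : hedges x -> frame x O i0 -> i' < m ->
  header_on (x c) y i' O' ->
  (exists J : int, O = O' + J * n%:Z)%R /\ i' = res m (i0 + c)%R.
Proof.
move=> hx fx im H; have m0 := m_gt0.
have H' : header_on (x (c + 1)%R) y (res m (i0 + (c + 1))%R) O.
  by move=> z J p _ _ zE pl; apply: fx zE pl.
have [? iE] := header_sync (hx c) im (res_lt m0 _) H H'; split=> //.
apply: (succ_mod_inj m0) => //; first exact: res_lt.
by rewrite -iE addrA res_succ.
Qed.

Lemma frame_labels x (c J : int) : hedges x -> vlegal x -> frame x 0%R 0%R ->
  exists l1 l2, [/\ l1 \in labels s T, l2 \in labels s T, vmatch2 s l1 l2,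
    forall q, q < n -> x c (J * n%:Z + q%:Z)%R = nth 0 (blk (res m c) l1) q &
    forall q, q < n -> x c ((J + 1) * n%:Z + q%:Z)%R = nth 0 (blk (res m c) l2) q].
Proof.
move=> hx vx fx; have n0 := height_gt0.
have [i [O [l1 [l2 [l3 xP]]]]] := parse_exists c (J * n%:Z)%R vx.
have im : i < m by case: xP => -[].
have [[J' OE] iE] : (exists J' : int, 0 = O + J' * n%:Z)%R /\ i = res m (0 + c)%R.
  by apply: (frame_pin (y := (J * n%:Z)%R) hx fx im); apply: (parse_header xP); lia.
case: xP => -[_ T1 T2 _] v12 Oy yO fE; rewrite add0r in iE; rewrite -iE.
have JE : (J' = - J)%R by nia.
have {}OE : O = (J * n%:Z)%R by lia.
exists l1, l2; split=> // q qn.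
  have := fE 0 q isT qn; rewrite OE mul0r addr0; apply; lia.
have := fE 1 q isT qn; rewrite OE mul1r mulrDl mul1r; apply; lia.
Qed.

Definition tiling (t : int -> int -> seq nat) : Prop :=
  [/\ forall I J, t I J \in T, forall I J, hmatch s (t I J) (t (I + 1)%R J) &
      forall I J, vmatch s (t I J) (t I (J + 1)%R)].

Definition build (t : int -> int -> seq nat) (c z : int) : nat :=
  nth 0 (blk (res m c) (t (quo m c - 1)%R (quo n z), t (quo m c) (quo n z)))
    (res n z).

Lemma frame_tiling x : hedges x -> vlegal x -> frame x 0%R 0%R ->
  exists2 t, tiling t & x = build t.
Proof.
move=> hx vx fx; have n0 := height_gt0; have m0 := m_gt0.
have /choice[l lP] (cJ : int * int) : exists l, l \in labels s T /\
    forall q, q < n -> x cJ.1 (cJ.2 * n%:Z + q%:Z)%R = nth 0 (blk (res m cJ.1) l) q.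
  by have [l1 [_ [? _ _ ? _]]] := frame_labels cJ.1 cJ.2 hx vx fx; exists l1.
have couple c J l1 : l1 \in labels s T ->
    (forall q, q < n -> x c (J * n%:Z + q%:Z)%R = nth 0 (blk (res m c) l1) q) ->
    l1.2 = if (res m c).+1 == m then (l ((c + 1)%R, J)).1 else (l ((c + 1)%R, J)).2.
  move=> l1T l1E; have [l2T l2E] := lP ((c + 1)%R, J).
  apply: block_couple; first exact: res_lt.
  - by move: l1T; rewrite mem_labels => /and3P[].
  - by move: l2T; rewrite mem_labels => /and3P[? ? _]; case: eqP.
  by move=> q qn; rewrite -res_succ // -l1E // -l2E.
pose t (I J : int) := (l ((I * m%:Z)%R, J)).2.
have tT (I J : int) : t I J \in T.
  by have [] := lP ((I * m%:Z)%R, J); rewrite mem_labels => /and3P[].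
have tE (I J : int) i : i < m -> (l ((I * m%:Z + i%:Z)%R, J)).2 = t I J.
  elim: i => [|i IH] im; first by rewrite addr0.
  rewrite -IH; last by lia.
  have [lT lE] := lP ((I * m%:Z + i%:Z)%R, J).
  rewrite (couple _ _ _ lT lE); have [_ ->] := quo_res_eq m0 I (ltnW im).
  by rewrite ltn_eqF // -addrA -PoszD addn1.
have tE0 (I J : int) : (l ((I * m%:Z)%R, J)).1 = t (I - 1)%R J.
  have m1 : m.-1 < m by lia.
  rewrite -(tE _ _ m.-1) //; have [lT lE] := lP (((I - 1) * m%:Z + m.-1%:Z)%R, J).
  rewrite (couple _ _ _ lT lE); have [_ ->] := quo_res_eq m0 (I - 1)%R m1.
  rewrite prednK // eqxx; congr (l (_, J)).1; rewrite mulrBl mul1r /=; lia.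
have tile (c J : int) : (l (c, J)).2 = t (quo m c) J.
  by rewrite {1}(quo_res m0 c) tE // res_lt.
exists t; last first.
  apply/funext => c; apply/funext => z; rewrite {1}(quo_res n0 z).
  have [_ ->] := lP (c, quo n z); last exact: res_lt.
  rewrite /build -tile; have [c0|c0] := eqVneq (res m c) 0.
    have cE := quo_res m0 c; rewrite c0 addr0 in cE.
    by rewrite -tE0 -cE -surjective_pairing.
  by case: (l _) => a b; rewrite (block_cons a (t (quo m c - 1)%R (quo n z))).
split=> // I J.
  have [] := lP (((I + 1) * m%:Z)%R, J); rewrite mem_labels tE0 addrK.
  by case/and3P.
have [l1 [l2 [l1T l2T /andP[_ v12] l1E l2E]]] := frame_labels (I * m%:Z)%R J hx vx fx.
have [lT lE] := lP ((I * m%:Z)%R, J); have [lT' lE'] := lP ((I * m%:Z)%R, (J + 1)%R).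
by rewrite /t (couple _ _ _ lT lE) -(couple _ _ _ l1T l1E)
  (couple _ _ _ lT' lE') -(couple _ _ _ l2T l2E).
Qed.

Lemma build_frame t : frame (build t) 0%R 0%R.
Proof.
move=> c z J p -> pl; rewrite /build !add0r.
have pn : p < n by rewrite (leq_trans pl) // leq_addr.
by have [-> ->] := quo_res_eq height_gt0 J pn; rewrite nth_block_hdr.
Qed.

Lemma build_hedges t : tiling t -> hedges (build t).
Proof.
move=> [tT tH _] c z; have m0 := m_gt0.
rewrite /build res_succ //; have cE := quo_res m0 c.
set i := res m c in cE *; have im : i < m by apply: res_lt.
have := block_walk (t (quo m c - 1) (quo n z))%R (t (quo m c) (quo n z))
  (t (quo m c + 1) (quo n z))%R im (res_lt height_gt0 z).
suff -> : (if i.+1 == m then (t (quo m c) (quo n z), t (quo m c + 1)%R (quo n z))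
   else (t (quo m c - 1)%R (quo n z), t (quo m c) (quo n z))) =
   (t (quo m (c + 1) - 1)%R (quo n z), t (quo m (c + 1)%R) (quo n z)) by [].
have [im1|im1] := eqVneq i.+1 m.
  suff -> : quo m (c + 1)%R = (quo m c + 1)%R by rewrite addrK.
  have [<- _] := quo_res_eq m0 (quo m c + 1)%R m0; congr quo.
  by rewrite mulrDl mul1r; lia.
suff -> : quo m (c + 1)%R = quo m c by [].
have im2 : i.+1 < m by lia.
have [<- _] := quo_res_eq m0 (quo m c) im2; congr quo.
by lia.
Qed.

Lemma build_vlegal t : tiling t -> vlegal (build t).
Proof.
move=> [tT tH tV] c y; have m0 := m_gt0; have n0 := height_gt0.
pose l J := (t (quo m c - 1)%R J, t (quo m c) J); pose J := quo n y.
have lT J' : l J' \in labels s T.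
  by rewrite mem_labels !tT /=; have := tH (quo m c - 1)%R J'; rewrite subrK.
have lV J' : vmatch2 s (l J') (l (J' + 1)%R) by rewrite /vmatch2 !tV.
apply/mem_legal; exists (res m c), (l J), (l (J + 1)%R), (l (J + 1 + 1)%R), (res n y).
split=> //; [by split=> //; apply: res_lt|exact: res_lt|].
have yn := res_lt n0 y.
apply: (@eq_from_nth _ 0).
  rewrite size_mkseq size_take size_drop (size_cat (blk _ (l J))).
  rewrite (size_cat (blk _ (l (J + 1)%R))) !size_block.
  by case: ltnP; lia.
rewrite size_mkseq => q qn; rewrite nth_mkseq // nth_take // nth_drop.
have -> : blk (res m c) (l J) ++ blk (res m c) (l (J + 1)%R) ++
    blk (res m c) (l (J + 1 + 1)%R) = flatten [seq blk (res m c) (l (J + j%:Z)%R) | j <- iota 0 3].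
  by rewrite /= cats0 addr0 -addrA.
rewrite (divn_eq (res n y + q) n) nth_flatten_uniform ?size_map ?size_iota; last 3 first.
- by apply/allP => u /mapP[j _ ->]; rewrite size_block.
- by rewrite ltn_divLR; lia.
- by rewrite ltn_mod.
rewrite (nth_map 0) ?size_iota; last by rewrite ltn_divLR; lia.
rewrite nth_iota; last by rewrite ltn_divLR; lia.
rewrite add0n /build.
have qr : (res n y + q) %% n < n by rewrite ltn_mod.
have [quoE resE] := quo_res_eq n0 (J + ((res n y + q) %/ n)%:Z)%R qr.
suff <- : ((J + ((res n y + q) %/ n)%:Z) * n%:Z + ((res n y + q) %% n)%:Z = y + q%:Z)%R.
  by rewrite quoE resE.
have yE := quo_res n0 y; rewrite -/J in yE; rewrite mulrDl -PoszM; have := divn_eq (res n y + q) n; lia.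
Qed.

Lemma build_inj t t' (I J : int) : tiling t -> tiling t' ->
  (forall q, q < n -> build t (I * m%:Z + 1)%R (J * n%:Z + q%:Z)%R =
                      build t' (I * m%:Z + 1)%R (J * n%:Z + q%:Z)%R) ->
  t I J = t' I J.
Proof.
move=> tP t'P H; have m0 := m_gt0; have n0 := height_gt0; have elt := e_lt.
have m1 : 1 < m by lia.
have [Q0 R0] := quo_res_eq m0 I m0; have [Q1 R1] := quo_res_eq m0 I m1.
have := @block_couple 0 (t (I - 1)%R J, t I J) (t' (I - 1)%R J, t' I J) m0.
rewrite /= (ltn_eqF m1); apply.
- by case: tP.
- by case: t'P.
move=> q qn; have [Qq Rq] := quo_res_eq n0 J qn.
have := build_hedges tP (I * m%:Z + 0%:Z)%R (J * n%:Z + q%:Z)%R.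
by rewrite addr0 H // /build Qq Rq Q1 R1 -[(I * m%:Z)%R]addr0 Q0 R0 modn_small.
Qed.
End Blocks.

(** * Continuity of local maps *)

Local Open Scope classical_set_scope.

Lemma nbhs_agree (A : finType) (S : set (config2 A)) (x : S) (L : seq (int * int)) :
  nbhs x [set x' : S | forall l, l \in L -> set_val x' l = set_val x l].
Proof.
elim: L => [|l L IH]; first by apply: filterS filterT.
have xl : nbhs x [set x' : S | set_val x' l = set_val x l].
  have := @initial_continuous S (config2 A) set_val x.
  move=> /(_ [set y : config2 A | y l = set_val x l]); apply.
  have := @proj_continuous (int * int)%type (fun=> discrete_topology A) l (set_val x).
  by move=> /(_ [set set_val x l] (discrete_set1 _)).
apply: filterS (filterI xl IH) => x' [/= H1 H2] j.
by rewrite inE => /orP[/eqP ->|/H2].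
Qed.

Lemma continuous_local (A B : finType) (S : set (config2 A)) (S' : set (config2 B))
    (f : S -> S') :
  (forall k, exists L : seq (int * int), forall x x' : S,
     (forall l, l \in L -> set_val x' l = set_val x l) ->
     set_val (f x') k = set_val (f x) k) ->
  continuous f.
Proof.
move=> fL; apply: (@continuous_comp_initial S' S (config2 B) set_val f) => x.
apply/(@cvg_sup _ _ _ _ _ (fmap_filter _ (nbhs_filter x))) => k U [?/= [[W oW <-]]] /= Wk /filterS; apply.
have [L LP] := fL k.
apply: filterS (nbhs_agree x L) => x' /LP E /=.
by rewrite E.
Qed.

Lemma clopen_local (A : finType) (S : set (config2 A)) (D : set S)
    (L : seq (int * int)) :
  (forall x x' : S, (forall l, l \in L -> set_val x' l = set_val x l) ->
     D x -> D x') ->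
  clopen D.
Proof.
move=> DL.
have open_local (C : set S) : (forall x x' : S,
    (forall l, l \in L -> set_val x' l = set_val x l) -> C x -> C x') -> open C.
  move=> CL; rewrite openE => x Cx; apply: filterS (nbhs_agree x L) => x' H.
  exact: CL H Cx.
split; first exact: open_local.
rewrite -[D]setCK; apply: open_closedC; apply: open_local => x x' H nD Dx'.
by apply: nD; apply: DL Dx' => l lL; rewrite H.
Qed.

(** * The root *)

Section Letters.
Variable A : finType.

Lemma enc_letter_lt (a : A) : enc_letter a < #|A|.
Proof. exact: ltn_ord. Qed.

Lemma enc_letter_inj : injective (@enc_letter A).
Proof. by move=> a b /val_inj/enum_rank_inj. Qed.

Lemma nth_enc_letter (a0 a : A) : nth a0 (enum A) (enc_letter a) = a.
Proof. exact: nth_enum_rank. Qed.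

Lemma enc_letter_nth (a0 : A) i : i < #|A| -> enc_letter (nth a0 (enum A) i) = i.
Proof.
move=> iA; rewrite -[i]/(nat_of_ord (Ordinal iA)) -enum_val_nth.
by rewrite /enc_letter enum_valK.
Qed.

Definition rank_words (F : seq (seq A)) : seq (seq nat) :=
  [seq [seq enc_letter a | a <- w] | w <- F].

Lemma edge_rank (F : seq (seq A)) a b :
  edge #|A| (rank_words F) (enc_letter a) (enc_letter b) = ([:: a; b] \notin F).
Proof.
rewrite /edge !enc_letter_lt -[[:: _; _]]/(map (@enc_letter A) [:: a; b]) mem_map //.
exact/inj_map/enc_letter_inj.
Qed.

Definition ranks (x : config2 A) (c z : int) : nat := enc_letter (x (c, z)).

Lemma ranks_inj x x' : ranks x = ranks x' -> x = x'.
Proof.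
move=> xx'; apply/funext => -[c z]; apply: enc_letter_inj.
exact: (congr1 (fun f => f c z) xx').
Qed.
End Letters.

Section Windows.
Variables (B : finType) (FY : seq (pattern2 B)).

Definition cell_code (c : (int * int) * B) : seq nat :=
  [:: enc_int c.1.1; enc_int c.1.2; enc_letter c.2].

Definition pattern_codes : seq (seq (seq nat)) :=
  [seq [seq cell_code c | c <- p] | p <- FY].

Let P := pattern_codes.
Let r := radius P.
Let s := side P.
Let T := tiles #|B| P.

Lemma leq_sumn n l : n \in l -> n <= sumn l.
Proof.
elim: l => //= a l IH; rewrite inE => /orP[/eqP -> |/IH]; first exact: leq_addr.
by move/leq_trans; apply; apply: leq_addl.
Qed.

Lemma positionE (p : pattern2 B) (c : int * int * B) z :
  p \in FY -> c \in p -> enc_int z \in cell_code c ->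
  position r (enc_int z) < s /\ ((position r (enc_int z))%:Z = z + r%:Z)%R.
Proof.
move=> pFY cp zc; have : enc_int z <= r.
  apply: leq_sumn; apply/flattenP; exists (cell_code c) => //.
  apply/flattenP; exists [seq cell_code c | c <- p]; exact: map_f.
rewrite /position /s /side -/r; case: z {zc} => j /=.
  by rewrite odd_double doubleK; lia.
by rewrite odd_double /= uphalf_double; lia.
Qed.

Definition win (y : config2 B) (I J : int) : seq nat :=
  mkseq (fun q => enc_letter
    (y (I + (q %% s)%:Z - r%:Z, J + (q %/ s)%:Z - r%:Z)%R)) (s * s).

Lemma tile_at_win y I J a b : a < s -> b < s ->
  tile_at s (win y I J) a b = enc_letter (y (I + a%:Z - r%:Z, J + b%:Z - r%:Z)%R).
Proof.
move=> al bl; rewrite /tile_at nth_mkseq; last by nia.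
by rewrite divnMDl ?divn_small ?addn0 // modnMDl modn_small.
Qed.

Lemma win_tiling y : sft2 FY y -> tiling s T (win y).
Proof.
move=> yY; split=> I J; last 2 first.
- apply/allP => b; rewrite mem_iota => bs; apply/allP => a; rewrite mem_iota => ax.
  rewrite !tile_at_win; [|lia..].
  by apply/eqP; congr (enc_letter (y (_, _))); lia.
- apply/allP => b; rewrite mem_iota => bs; apply/allP => a; rewrite mem_iota => ax.
  rewrite !tile_at_win; [|lia..].
  by apply/eqP; congr (enc_letter (y (_, _))); lia.
rewrite mem_filter mem_words size_mkseq eqxx andTb; apply/andP; split; last first.
  by apply/allP => n /mapP[q _ ->]; apply: enc_letter_lt.
apply/allP => _ /mapP[p pFY ->]; apply: contraT => nh.
case: (yY p pFY (I, J)) => c cp; apply: enc_letter_inj.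
move/hasPn: nh => /(_ (cell_code c) (map_f _ cp)); rewrite negbK => /eqP H.
rewrite -[RHS]/(nth 0 (cell_code c) 2) -H.
have [c1 c1E] := positionE pFY cp (mem_head _ _).
have [c2 c2E] : position r (enc_int c.1.2) < s /\
    ((position r (enc_int c.1.2))%:Z = c.1.2 + r%:Z)%R.
  by apply: positionE pFY cp _; rewrite /cell_code !inE eqxx orbT.
rewrite tile_at_win // c1E c2E; congr (enc_letter (y _)).
by case: c {H cp c1 c1E c2 c2E} => -[z1 z2] b /=; congr (_, _); rewrite /=; lia.
Qed.

Lemma shift_position (f : int -> nat -> nat) :
  (forall I a, a.+1 < s -> f I a.+1 = f (I + 1)%R a) ->
  forall (I : int) a c, a < s -> c < s -> f I a = f (I + a%:Z - c%:Z)%R c.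
Proof.
move=> H; have G d I a : a + d < s -> f I (a + d) = f (I + d%:Z)%R a.
  elim: d I => [|d IH] I; first by rewrite addn0 addr0.
  rewrite addnS => ads; rewrite H // IH ?(ltnW ads) //.
  by have -> : (I + 1 + d%:Z = I + d.+1%:Z)%R by lia.
move=> I a c al cl; have [ca|ac] := leqP c a.
  rewrite -{1}(subnKC ca) G ?subnKC //.
  by have -> : (I + (a - c)%:Z = I + a%:Z - c%:Z)%R by lia.
rewrite -[X in _ = f _ X](subnKC (ltnW ac)) G ?subnKC ?(ltnW ac) //.
by have -> : (I + a%:Z - c%:Z + (c - a)%:Z = I)%R by lia.
Qed.

Lemma tiling_win t : tiling s T t -> exists2 y, sft2 FY y & t = win y.
Proof.
move=> [tT tH tV].
have rs : r < s by rewrite /s /side -/r; lia.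
have sz I J : size (t I J) = s * s.
  by have := tT I J; rewrite mem_filter mem_words => /and3P[_ /eqP ->].
have lt I J a b : a < s -> b < s -> tile_at s (t I J) a b < #|B|.
  move=> al bl; have := tT I J; rewrite mem_filter mem_words => /and3P[_ _].
  by move=> /all_nthP; apply; rewrite sz; nia.
have b0 : B := enum_val (Ordinal (lt 0%R 0%R r r rs rs)).
pose y : config2 B := fun u => nth b0 (enum B) (tile_at s (t u.1 u.2) r r).
have yE I J a b : a < s -> b < s -> tile_at s (t I J) a b =
    enc_letter (y (I + a%:Z - r%:Z, J + b%:Z - r%:Z)%R).
  move=> al bl; rewrite enc_letter_nth ?lt //=.
  rewrite (@shift_position (fun I a => tile_at s (t I J) a b) _ I a r) //; last first.
    move=> I' a' a's; have /allP/(_ b) := tH I' J; rewrite mem_iota => /(_ bl)/allP/(_ a').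
    by rewrite mem_iota => /(_ _)/eqP; apply; lia.
  rewrite (@shift_position (fun J b => tile_at s (t (I + a%:Z - r%:Z)%R J) r b) _ J b r) //.
  move=> J' b' b's; have /allP/(_ b') := tV (I + a%:Z - r%:Z)%R J'.
  rewrite mem_iota => /(_ _)/allP H; move: H => /(_ _ r); rewrite mem_iota.
  by move=> H; apply/eqP/H => //; lia.
have tE : t = win y.
  apply/funext => I; apply/funext => J; apply: (@eq_from_nth _ 0).
    by rewrite sz size_mkseq.
  rewrite sz => q qs; have s0 : 0 < s by lia.
  rewrite nth_mkseq // -yE ?ltn_mod ?ltn_divLR //.
  by rewrite /tile_at -divn_eq.
exists y => // p pFY u pu.
have := tT u.1 u.2; rewrite mem_filter => /andP[/allP/(_ _ (map_f _ pFY)) + _].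
case/hasP => _ /mapP[c cp ->] /eqP; apply.
have [c1 c1E] := positionE pFY cp (mem_head _ _).
have [c2 c2E] : position r (enc_int c.1.2) < s /\
    ((position r (enc_int c.1.2))%:Z = c.1.2 + r%:Z)%R.
  by apply: positionE pFY cp _; rewrite /cell_code !inE eqxx orbT.
rewrite yE // c1E c2E /= -(pu c cp); congr (enc_letter (y _)).
by case: (u) (c.1) => u1 u2 [z1 z2] /=; congr (_, _); rewrite /=; lia.
Qed.

Lemma win_inj y y' : win y = win y' -> y = y'.
Proof.
move=> E; apply/funext => -[I J]; apply: enc_letter_inj.
have rs : r < s by rewrite /s /side -/r; lia.
have := tile_at_win y I J rs rs; rewrite E tile_at_win // !addrK.
by move=> ->.
Qed.
End Windows.

Section Root.
Variables (A B : finType) (FH : seq (seq A)) (FY : seq (pattern2 B)) (a0 : A).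
Variables (m e : nat) (al be : seq nat) (hdr : seq (seq nat)).
Let k := #|A|.
Let F := rank_words FH.
Let s := side (pattern_codes FY).
Let T := tiles #|B| (pattern_codes FY).
Let n := height m e hdr T.
Hypothesis FH2 : forbids_pairs FH.
Hypothesis data_ok : good_data k F m e al be.
Hypothesis hdr_ok : good_header k F m n hdr.

Definition unrank_words : seq (seq nat) -> seq (seq A) :=
  map (map (nth a0 (enum A))).

Let FV := unrank_words (forbidden k s m e al be hdr T).
Let X := combined (sft1 FH) (sft1 FV).
Local Notation bld := (build m e al be hdr T).

Lemma row_edges (x : config1 A) :
  sft1 FH x <-> forall i, edge k F (enc_letter (x i)) (enc_letter (x (i + 1)%R)).
Proof.
split=> [xH i|xE w wF i wi].
  rewrite edge_rank; apply/negP => /xH /(_ i); apply.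
  by rewrite /word_at /mkseq /= addr0.
have /eqP w2 := allP FH2 _ wF.
have := xE i; rewrite edge_rank => /negP; apply.
suff -> : [:: x i; x (i + 1)%R] = w by [].
by rewrite -wi w2 /mkseq /= addr0.
Qed.

Lemma col_legal (x : config1 A) : sft1 FV x <->
  forall y, mkseq (fun q => enc_letter (x (y + q%:Z)%R)) (n + n)
    \in legal s m e al be hdr T.
Proof.
split=> [xV y|xL w /mapP[v vF ->] y].
  apply: contraT => wl; set w := mkseq _ _ in wl.
  have sw : size w = n + n by rewrite size_mkseq.
  case: (xV (map (nth a0 (enum A)) w) _ y).
    apply: map_f; rewrite mem_filter wl mem_words size_mkseq eqxx /=.
    by apply/allP => _ /mapP[q _ ->]; apply: enc_letter_lt.
  rewrite /word_at size_map sw /w /mkseq -map_comp; apply: eq_map => q /=.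
  by rewrite nth_enc_letter.
move: vF; rewrite mem_filter mem_words => /and3P[vl /eqP sv /allP vk].
rewrite /word_at size_map sv => yE; case/negP: vl.
suff -> : v = mkseq (fun q => enc_letter (x (y + q%:Z)%R)) (n + n) by [].
have := congr1 (map (@enc_letter A)) yE; rewrite /mkseq -!map_comp => ->.
rewrite -[LHS]map_id; apply/eq_in_map => i iv /=.
by rewrite enc_letter_nth ?vk.
Qed.

Lemma mem_combined x :
  X x <-> hedges k F (ranks x) /\ vlegal s m e al be hdr T (ranks x).
Proof.
split=> [xX|[hx vx] c z].
  by split=> c z; have [/row_edges H /col_legal H'] := xX c z; [apply: H|apply: H'].
by split; [apply/row_edges => i; apply: hx | apply/col_legal => y; apply: vx].
Qed.

Let Z : set (config2 A) := [set x | X x /\ frame m e hdr T (ranks x) 0%R 0%R].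

Lemma m_pos : 0 < m. Proof. exact: m_gt0 data_ok hdr_ok. Qed.
Lemma n_pos : 0 < n. Proof. exact: height_gt0 hdr_ok. Qed.

Lemma ranks_shift a b (x : config2 A) c z :
  ranks (shift (a, b) x) c z = ranks x (c - a)%R (z - b)%R.
Proof. by []. Qed.

Lemma shiftK v (x : config2 A) : shift v (shift (- v)%R x) = x.
Proof. by apply/funext => u; rewrite /shift opprK subrK. Qed.

Lemma combined_shift v x : X x -> X (shift v x).
Proof.
case: v => a b /mem_combined[hx vx]; apply/mem_combined; split=> c z.
  rewrite !ranks_shift; have -> : (c + 1 - a = c - a + 1)%R by lia.
  exact: hx.
suff -> : (fun q : nat => ranks (shift (a, b) x) c (z + q%:Z)%R) =
          (fun q : nat => ranks x (c - a)%R (z - b + q%:Z)%R) by exact: vx.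
by apply/funext => q; rewrite ranks_shift; congr (ranks x _ _); lia.
Qed.

Lemma frame_shift a b O i (x : config2 A) : frame m e hdr T (ranks x) O i ->
  frame m e hdr T (ranks (shift (a, b) x)) (O + b)%R (i - a)%R.
Proof.
move=> fx c z J p zE pl; rewrite ranks_shift (fx _ _ J p) //; last by lia.
by rewrite addrA [(i - a + c)%R]addrAC.
Qed.

Lemma frame_mod (K L O i : int) x : frame m e hdr T x O i ->
  frame m e hdr T x (O + L * n%:Z)%R (i + K * m%:Z)%R.
Proof.
move=> fx c z J p zE pl; rewrite (fx _ _ (J + L)%R p) //; last first.
  by rewrite zE mulrDl -!addrA; congr (_ + _)%R; lia.
by rewrite [(i + _ + c)%R]addrAC resD.
Qed.

Lemma frame_uniq x O i O' i' : hedges k F x -> frame m e hdr T x O i ->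
  frame m e hdr T x O' i' ->
  (exists J : int, O = O' + J * n%:Z)%R /\ res m i = res m i'.
Proof.
move=> hx fx fx'.
have H : header_on m e hdr T (x 0%R) 0%R (res m i') O'.
  by move=> z J p _ _ zE pl; rewrite (fx' _ _ _ _ zE pl) addr0.
have [OE ->] := frame_pin data_ok hdr_ok hx fx (res_lt m_pos _) H.
by rewrite addr0.
Qed.

Lemma Z_header (x : config2 A) : X x ->
  (forall p, p < size hdr -> ranks x 0%R p = nth 0 (nth [::] hdr p) 0) -> Z x.
Proof.
move=> xX xh; split=> //; have [hx vx] := (mem_combined x).1 xX.
have [O [i [On im fx]]] := frame_exists data_ok hdr_ok hx vx.
have H : header_on m e hdr T (ranks x 0%R) 0%R 0 0%R.
  move=> z J p z0 zn zE pl.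
  have pn : p < n by rewrite (leq_trans pl) // leq_addr.
  have J0 : J = 0%R by rewrite -/n in zn zE; nia.
  by rewrite zE J0 mul0r !add0r xh.
have [[J OE] iE] := frame_pin data_ok hdr_ok hx fx m_pos H.
have [_] := quo_res_eq m_pos 0 im; rewrite mul0r add0r => iE'.
rewrite addr0 iE' in iE; rewrite -iE in fx.
suff O0 : O = 0 by rewrite O0 in fx.
by have [_ <-] := quo_res_eq n_pos 0 On; rewrite mul0r add0r OE resD /res mod0z.
Qed.

Lemma Z_shift (K L : int) x : Z x -> Z (shift (K * m%:Z, L * n%:Z)%R x).
Proof.
move=> [xX fx]; split; first exact: combined_shift.
have := @frame_mod K (- L)%R _ _ _ (@frame_shift (K * m%:Z)%R (L * n%:Z)%R _ _ _ fx).
by rewrite !add0r addNr mulNr subrr.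
Qed.

Lemma Z_image (K L : int) : shift (K * m%:Z, L * n%:Z)%R @` Z = Z.
Proof.
apply/seteqP; split=> [_ [x Zx <-]|x Zx]; first exact: Z_shift.
exists (shift (- K * m%:Z, - L * n%:Z)%R x); first exact: Z_shift.
by rewrite !mulNr; exact: shiftK.
Qed.

Lemma root_partition :
  let D := [set ij : nat * nat | (ij.1 < m) && (ij.2 < n)] in
  let G ij := shift (ij.1%:Z, ij.2%:Z)%R @` Z in
  X = \bigcup_(ij in D) G ij /\ trivIset D G.
Proof.
move=> D G; have m0 := m_pos; have n0 := n_pos; split.
  apply/seteqP; split=> [x xX|x [ij _ [z [zX _] <-]]]; last exact: combined_shift.
  have [hx vx] := (mem_combined x).1 xX.
  have [O [i [On im fx]]] := frame_exists data_ok hdr_ok hx vx.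
  have aE := quo_res m0 (- i%:Z)%R; set a := res _ _ in aE.
  exists (a, O); first by rewrite /D /= On res_lt.
  exists (shift (- (a%:Z, O%:Z))%R x); last exact: shiftK.
  split; first exact: combined_shift.
  have := @frame_mod (quo m (- i%:Z)%R) 0%R _ _ _ (@frame_shift (- a%:Z)%R (- O%:Z)%R _ _ _ fx).
  rewrite mul0r addr0 subrr opprK; set i' := (X in frame _ _ _ _ _ _ X).
  by have -> : i' = 0%R by rewrite /i'; lia.
apply/trivIsetP => -[a b] [a' b'] /andP[/= am bn] /andP[/= a'm b'n].
move=> ne; apply/disjoints_subset => x [z [zX fz] <-] [z' [_ fz'] zz'].
case/eqP: ne.
have [hx _] := (mem_combined _).1 (combined_shift (a%:Z, b%:Z)%R zX).
have f1 := @frame_shift (Posz a) (Posz b) _ _ _ fz; have f2 := @frame_shift (Posz a') (Posz b') _ _ _ fz'.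
rewrite zz' in f2; have [[J bE] aE] := frame_uniq hx f1 f2.
have {}bE : b = b'.
  have [_ <-] := quo_res_eq n0 0%R bn; have [_ <-] := quo_res_eq n0 0%R b'n.
  by rewrite !mul0r; rewrite add0r in bE; rewrite !add0r bE add0r resD.
congr (_, _) => //; rewrite !add0r in aE.
have r1 := quo_res m0 (- a%:Z)%R; have r2 := quo_res m0 (- a'%:Z)%R.
have E : (a'%:Z = a%:Z + (quo m (- a%:Z) - quo m (- a'%:Z)) * m%:Z)%R.
  by rewrite mulrBl; rewrite aE in r1; lia.
have [_ <-] := quo_res_eq m0 0%R am; have [_ <-] := quo_res_eq m0 0%R a'm.
by rewrite !mul0r !add0r E resD.
Qed.

Lemma win_build y : sft2 FY y -> exists2 x, Z x & ranks x = bld (win FY y).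
Proof.
move=> yY; have yT := win_tiling yY.
have hb := build_hedges data_ok hdr_ok yT.
pose x : config2 A := fun u => nth a0 (enum A) (bld (win FY y) u.1 u.2).
have xE : ranks x = bld (win FY y).
  apply/funext => c; apply/funext => z; rewrite /ranks /x enc_letter_nth //=.
  by have /and3P[] := hb c z.
exists x => //; split; last by rewrite xE; exact: (build_frame al be hdr_ok).
by apply/mem_combined; rewrite xE; split=> //; exact: (build_vlegal data_ok hdr_ok yT).
Qed.

Lemma build_win x : Z x -> exists2 y, sft2 FY y & ranks x = bld (win FY y).
Proof.
move=> [/mem_combined[hx vx] fx].
have [t tT ->] := frame_tiling data_ok hdr_ok hx vx fx.
by have [y yY ->] := tiling_win tT; exists y.
Qed.

Lemma build_shift t (K L c z : int) :
  bld t (c - K * m%:Z)%R (z - L * n%:Z)%R = bld (fun I J => t (I - K)%R (J - L)%R) c z.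
Proof.
have sh d (D w : int) : 0 < d -> quo d (w - D * d%:Z)%R = (quo d w - D)%R /\
    res d (w - D * d%:Z)%R = res d w.
  move=> d0; have := quo_res_eq d0 (quo d w - D) (res_lt d0 w).
  by rewrite mulrBl addrAC -quo_res.
rewrite /build; have [-> ->] := sh m K c m_pos.
have [-> ->] := sh n L z n_pos.
by rewrite [(_ - K - 1)%R]addrAC.
Qed.

Lemma is_root_combined : is_root m n X (sft2 FY).
Proof.
exists Z; split.
- split; first by move=> x [].
  pose L : seq (int * int) := [seq (0%R, p%:Z)%R | p <- iota 0 (size hdr)].
  apply: (@clopen_local _ _ _ L) => x x' H [_ fx]; apply: Z_header.
    exact: (set_valP x').
  move=> p pl; rewrite /ranks H; last by apply: map_f; rewrite mem_iota.
  rewrite -[LHS]/(ranks (set_val x) 0%R p%:Z%R) (fx _ _ 0%R p) //.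
  by rewrite /res mod0z.
- by have := Z_image 1%R 0%R; rewrite mul1r mul0r.
- by have := Z_image 0%R 1%R; rewrite mul1r mul0r.
- have /choice[phi phiP] (x : Z) : exists y : sft2 FY,
      ranks (set_val x) = bld (win FY (set_val y)).
    have [y yY E] := build_win (set_valP x).
    by exists (exist _ y (mem_set yY)).
  have /choice[psi psiP] (y : sft2 FY) : exists x : Z,
      ranks (set_val x) = bld (win FY (set_val y)).
    have [x xZ E] := win_build (set_valP y).
    by exists (exist _ x (mem_set xZ)).
  have winT (y : sft2 FY) : tiling s T (win FY (set_val y)).
    exact: win_tiling (set_valP y).
  exists phi, psi; split.
  + apply: continuous_local => -[I J].
    exists [seq (I * m%:Z + 1, J * n%:Z + q%:Z)%R | q <- iota 0 n] => x x' H.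
    apply: enc_letter_inj.
    have rs : radius (pattern_codes FY) < s by rewrite /s /side; lia.
    have W : win FY (set_val (phi x')) I J = win FY (set_val (phi x)) I J.
      apply: (build_inj data_ok hdr_ok) => // q qn.
      rewrite -!phiP /ranks H //.
      by apply: (map_f (fun q : nat => (I * m%:Z + 1, J * n%:Z + q%:Z)%R)); rewrite mem_iota.
    have := tile_at_win (set_val (phi x')) I J rs rs.
    by rewrite W tile_at_win // !addrK => <-.
  + apply: continuous_local => -[c z].
    pose r := radius (pattern_codes FY).
    pose L (I J : int) : seq (int * int) :=
      [seq (I + (q %% s)%:Z - r%:Z, J + (q %/ s)%:Z - r%:Z)%R | q <- iota 0 (s * s)].
    exists (L (quo m c - 1)%R (quo n z) ++ L (quo m c) (quo n z)) => y y' H.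
    apply: enc_letter_inj; rewrite -!/(ranks _ _ _) !psiP.
    have W I J : {subset L I J <= L (quo m c - 1)%R (quo n z) ++ L (quo m c) (quo n z)} ->
        win FY (set_val y') I J = win FY (set_val y) I J.
      move=> LS; apply/eq_in_map => q qs; rewrite H //; apply/LS.
      exact: (map_f (fun q => (I + (q %% s)%:Z - r%:Z, J + (q %/ s)%:Z - r%:Z)%R)).
    by rewrite /build !W // => l lL; rewrite mem_cat lL ?orbT.
  + move=> x; apply: val_inj; apply: ranks_inj.
    by rewrite -!set_valE psiP phiP.
  + move=> y; apply: val_inj; apply: (@win_inj _ FY); apply/funext => I; apply/funext => J.
    rewrite -!set_valE; apply: (build_inj data_ok hdr_ok) => // q qn.
    by rewrite -phiP psiP.
  move=> K L x x' xx'; apply: (@win_inj _ FY).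
  pose t I J := win FY (set_val (phi x)) (I - K)%R (J - L)%R.
  have tT : tiling s T t.
    have [t1 t2 t3] := winT (phi x); rewrite /t; split=> I J //.
      by have -> : (I + 1 - K = I - K + 1)%R by lia.
    by have -> : (J + 1 - L = J - L + 1)%R by lia.
  have -> : win FY (shift (K, L) (set_val (phi x))) = t.
    apply/funext => I; apply/funext => J; apply: eq_map => q; congr enc_letter.
    by rewrite /shift; congr (set_val (phi x) (_, _)); rewrite /=; lia.
  apply/funext => I; apply/funext => J.
  apply: (build_inj data_ok hdr_ok) => // q qn.
  by rewrite -phiP xx' ranks_shift phiP build_shift.
exact: root_partition.
Qed.
End Root.

(** * Walks in strongly connected components *)

Section Walks.
Variables (A : finType) (g : rel A).

Fixpoint walk (n : nat) (a b : A) : bool :=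
  if n is n'.+1 then [exists c, g a c && walk n' c b] else a == b.

Lemma walk1 a b : walk 1 a b = g a b.
Proof.
apply/existsP/idP => [[c /andP[ac /eqP <-]] //|ab].
by exists b; rewrite ab /=.
Qed.

Lemma walkD m n a b :
  walk (m + n) a b <-> exists c, walk m a c /\ walk n c b.
Proof.
elim: m a => [|m IH] a.
  by split=> [ab|[c [/eqP -> //]]]; exists a; rewrite /= eqxx.
split=> [/existsP[c /andP[ac /IH[d [cd db]]]]|[d [/existsP[c /andP[ac cd]] db]]].
  by exists d; split=> //; apply/existsP; exists c; rewrite ac.
by apply/existsP; exists c; rewrite ac /=; apply/IH; exists d.
Qed.

Lemma walk_cat m n a b c : walk m a b -> walk n b c -> walk (m + n) a c.
Proof. by move=> ab bc; apply/walkD; exists b. Qed.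

Lemma walk_loop q n a : walk n a a -> walk (q * n) a a.
Proof.
by move=> aa; elim: q => [|q IH]; [exact: eqxx | exact: walk_cat aa IH].
Qed.

Definition is_walk (f : nat -> A) n := forall i, i < n -> g (f i) (f i.+1).

Lemma walkP n a b : walk n a b -> exists f, [/\ f 0 = a, f n = b & is_walk f n].
Proof.
elim: n a => [|n IH] a /=; first by move/eqP->; exists (fun=> b).
case/existsP => c /andP[ac /IH[f [f0 fn fP]]].
exists (fun i => if i is i'.+1 then f i' else a); split=> // -[_|i]; first by rewrite f0.
exact: fP.
Qed.

Lemma walk_glue f f' p q : is_walk f p -> is_walk f' q -> f p = f' 0 ->
  is_walk (fun i => if i <= p then f i else f' (i - p)) (p + q).
Proof.
move=> fP f'P E i ipq; case: ltngtP => [ip|ip|ip].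
- exact: fP.
- by rewrite subSn; [apply: f'P; lia | lia].
- by rewrite ip subSn // subnn E; apply: f'P; lia.
Qed.

Lemma walk_periodic : exists2 N, 0 < N & forall x a b, N <= x ->
  walk (x + N) a b = walk x a b.
Proof.
pose w n := [ffun p : A * A => walk n p.1 p.2].
have [i [j [ij wij]]] : exists i j, i < j /\ w i = w j.
  pose M := #|{ffun A * A -> bool}|.
  have /injectivePn[x [y xy wxy]] : ~~ injectiveb (fun i : 'I_M.+1 => w i).
    apply/negP => /injectiveP inj; have := leq_card _ inj.
    by rewrite card_ord ltnn.
  by have [?|?|/val_inj xy'] := ltngtP x y; [exists x, y|exists y, x|rewrite xy' eqxx in xy].
have per x a b : i <= x -> walk (x + (j - i)) a b = walk x a b.
  move=> ix; have -> : x + (j - i) = j + (x - i) by lia.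
  have wE c : walk j a c = walk i a c.
    by have := congr1 (fun h : {ffun A * A -> bool} => h (a, c)) wij; rewrite !ffunE.
  rewrite -{2}(subnKC ix); apply/idP/idP => /walkD[c [ac cb]]; apply: walk_cat cb.
    by rewrite -wE.
  by rewrite wE.
exists (i.+1 * (j - i)) => [|x a b Nx]; first by rewrite muln_gt0 subn_gt0.
have ix : i <= x by nia.
by elim: i.+1 => [|q IH]; rewrite ?addn0 // mulSn addnCA addnC per ?IH //; lia.
Qed.

Section Period.
Variable N : nat.
Hypothesis N0 : 0 < N.
Hypothesis walkN : forall x a b, N <= x -> walk (x + N) a b = walk x a b.

Lemma walk_mod x y a b : N <= x -> N <= y -> x = y %[mod N] ->
  walk x a b -> walk y a b.
Proof.
have G q z : N <= z -> walk (z + q * N) a b = walk z a b.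
  by move=> Nz; elim: q => [|q IH]; rewrite ?addn0 // mulSn addnCA addnC walkN ?IH //; lia.
wlog xy : x y / x <= y => [H Nx Ny E|Nx Ny E].
  case: (leqP x y) => [xy|/ltnW yx]; first exact: H.
  move: E Nx Ny; rewrite -(subnK yx) => E _ Ny.
  have /dvdnP[q ->] : N %| x - y by rewrite -eqn_mod_dvd // -E subnK.
  by rewrite addnC G.
have /dvdnP[q yx] : N %| y - x by rewrite -eqn_mod_dvd // E.
by rewrite -(subnKC xy) yx G.
Qed.

Definition component (S : set A) : Prop :=
  (forall v w, S v -> S w -> exists2 l, 0 < l & walk l v w) /\
  (forall v x w l l', S v -> S w -> walk l v x -> walk l' x w -> S x).

Variable S : set A.
Hypothesis S_comp : component S.

Lemma walk_back x y v w : S v -> S w -> walk x v w -> N %| x + y -> N <= y ->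
  walk y w v.
Proof.
move=> Sv Sw vw xy Ny; have [l l0 wv] := S_comp.1 w v Sw Sv.
have := walk_cat wv (walk_loop N.-1 (walk_cat vw wv)).
apply: walk_mod => //; first by nia.
apply/eqP; rewrite -(eqn_modDr x) addnC [_ + x]addnC.
have -> : x + (l + N.-1 * (x + l)) = (x + l) * N by rewrite -[in RHS](prednK N0); nia.
by rewrite modnMl eq_sym.
Qed.

Lemma walk_refl v : S v -> walk N v v.
Proof.
move=> Sv; have [l l0 vv] := S_comp.1 v v Sv Sv.
by apply: walk_mod (walk_loop N vv); rewrite ?modnn ?modnMr //; nia.
Qed.

Lemma walk_reflM q v : 0 < q -> S v -> walk (q * N) v v.
Proof. by move=> q0 Sv; apply: walk_loop; apply: walk_refl. Qed.

Lemma step_power d : 1 < d ->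
  (forall v w, S v -> S w -> walk d v w -> g v w) ->
  forall v w, S v -> S w -> walk N.+1 v w -> g v w.
Proof.
move=> d1 dg v w Sv Sw vw.
have H q : forall u, S u -> walk (1 + q * d.-1) v u -> g v u.
  elim: q => [|q IH] u Su; first by rewrite mul0n addn0 walk1.
  rewrite mulSn addnC -addnA [_ + 1]addnC addnC => /walkD[x [vx xu]].
  have Sx := S_comp.2 _ _ _ _ _ Sv Su vx xu.
  have := IH x Sx vx; rewrite -walk1 => /walk_cat/(_ xu).
  by rewrite add1n prednK; [apply: dg|lia].
apply: (H N) => //; apply: walk_mod vw; [lia|nia|].
by rewrite -addn1 modnDl [1 + _]addnC mulnC modnMDl.
Qed.

Lemma step_power_rev d : 1 < d ->
  (forall v w, S v -> S w -> walk d w v -> g v w) ->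
  forall v w, S v -> S w -> walk N.+1 v w -> g v w.
Proof.
move=> d1 dg; apply: (@step_power (d * d)); first by nia.
have H q : forall v w, S v -> S w -> walk (q * d) v w -> walk q w v.
  elim: q => [|q IH] v w Sv Sw; first by rewrite /= eq_sym.
  rewrite mulSn => /walkD[x [vx xw]].
  have Sx := S_comp.2 _ _ _ _ _ Sv Sw vx xw.
  by rewrite -addn1; apply: walk_cat (IH _ _ Sx Sw xw) _; rewrite walk1; apply: dg.
by move=> v w Sv Sw /(H _ _ _ Sv Sw); apply: dg.
Qed.

(* The classes of a cyclic partition are the sets of points at distance
   [N + i] from a base point. *)
Lemma state_split (E : A -> A -> Prop) :
  S !=set0 -> (forall v w, S v -> S w -> (E v w <-> g v w)) ->
  (forall v w, S v -> S w -> walk N.+1 v w -> g v w) ->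
  state_split_cycle_type E S.
Proof.
move=> [v0 Sv0] Eg full.
pose opp x := x * N.-1 + N.
have oppD x : x + opp x = x.+1 * N.
  by rewrite /opp addnA -mulnS prednK // mulSn addnC.
have back x v w : S v -> S w -> walk x v w -> walk (opp x) w v.
  move=> Sv Sw vw; apply: walk_back vw _ _ => //; first by rewrite oppD dvdn_mull.
  exact: leq_addl.
have oppM x y v w : walk (opp x + (x + y)) v w -> N <= y -> walk y v w.
  move=> vw Ny; apply: walk_mod vw => //; first by rewrite /opp [_ + N]addnC -!addnA leq_addr.
  by rewrite addnA [opp x + x]addnC oppD modnMDl.
have [p /andP[p0 pp] pmin] := @ex_minnP (fun p => (0 < p) && walk (N + p) v0 v0)
  (ex_intro _ N (introT andP (conj N0 (eq_ind_r (fun x => walk x v0 v0)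
    (walk_reflM (isT : 0 < 2) Sv0) (etrans (addnn N) (esym (mul2n N))))))).
pose V i : set A := [set w | S w /\ walk (N + i) v0 w].
have reduce l w : S w -> walk (N + l) v0 w -> p <= l -> walk (N + (l - p)) v0 w.
  move=> Sw v0w pl; apply: (@oppM (N + p)); last exact: leq_addr.
  have -> : N + p + (N + (l - p)) = N + (N + l) by lia.
  rewrite addnA; apply: walk_cat v0w; apply: walk_cat (walk_refl Sv0).
  exact: back pp.
have closeV w : S w -> walk (N + p) v0 w <-> walk (N + 0) v0 w.
  move=> Sw; split=> [v0w|]; first by have := reduce _ _ Sw v0w (leqnn p); rewrite subnn.
  by rewrite addn0 => v0w; move: (walk_cat pp v0w); rewrite walkN // leq_addr.
exists p, V; split=> //.
  split.
  - apply/seteqP; split=> [w [i _ [Sw _]] //|w Sw].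
    have [l _ v0w] := S_comp.1 v0 w Sv0 Sw.
    have := walk_cat (walk_refl Sv0) v0w; elim/ltn_ind: l {v0w} => l IH v0w.
    have [lp|pl] := ltnP l p; first by exists l.
    by apply: IH (reduce _ _ Sw v0w pl); lia.
  - have H i j w : i < j -> j < p -> V i w -> V j w -> False.
      move=> ij jp [Sw wi] [_ wj].
      have := walk_cat wj (back _ _ _ Sv0 Sw wi); rewrite addnC => c.
      have : walk (N + (j - i)) v0 v0.
        apply: (@oppM (N + i)); last exact: leq_addr.
        have -> : N + i + (N + (j - i)) = N + (N + j) by lia.
        rewrite addnA addnC addnA [_ + opp _]addnC; apply: walk_cat c _.
        exact: walk_refl.
      by move=> jj; have := pmin (j - i); rewrite jj subn_gt0 ij => /(_ isT); lia.
    move=> i j /= ip jp [w [Vi Vj]]; have [ij|ji|//] := ltngtP i j.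
      by case: (H i j w).
    by case: (H j i w).
  move=> i ip; have := walk_reflM (isT : 0 < (N + i).+1) Sv0.
  rewrite -oppD => /walkD[w [v0w wv0]]; exists w; split=> //.
  exact: (S_comp.2 _ _ _ _ _ Sv0 Sv0 v0w wv0).
move=> i v w ip [Sv v0v] Sw.
have step : E v w <-> walk (N + i.+1) v0 w.
  rewrite Eg //; split=> [vw|v0w].
    by rewrite addnS -addn1; apply: walk_cat v0v _; rewrite walk1.
  apply: full => //; apply: (@oppM (N + i)); last by lia.
  have -> : N + i + N.+1 = N + (N + i.+1) by lia.
  rewrite addnA; apply: walk_cat v0w; apply: walk_cat (walk_refl Sv0).
  exact: back v0v.
have [ip'|pi|ip'] := ltngtP i.+1 p; [|lia|].
  by rewrite modn_small //; split=> [/step|[_ /step]].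
rewrite ip' modnn step ip'; split=> [/(closeV _ Sw)|[_ /(closeV _ Sw)]] //.
Qed.
End Period.
End Walks.

Section Rauzy.
Variables (A : finType) (FH : seq (seq A)).
Hypothesis FH2 : forbids_pairs FH.
Let g (a b : A) := [:: a; b] \notin FH.
Let E := rauzy (sft1 FH).

Lemma rauzy_edge a b : E a b -> g a b.
Proof. by move=> [x xH [i wi]]; apply/negP => /xH /(_ i). Qed.

Lemma loop_rauzy f m : 0 < m -> f 0 = f m -> is_walk g f m ->
  forall i, i < m -> E (f i) (f i.+1).
Proof.
move=> m0 fm fP i im.
have fS j : j < m -> f (j.+1 %% m) = f j.+1.
  move=> jm; have [->|j1] := eqVneq j.+1 m; first by rewrite modnn.
  by rewrite modn_small // ltn_neqAle j1.
exists (fun z => f (res m z)).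
  apply/(row_edges FH2) => z; rewrite edge_rank res_succ // fS ?res_lt //.
  by apply: fP; apply: res_lt.
have [_ iE] := quo_res_eq m0 0%R im; rewrite mul0r add0r in iE.
exists i%:Z%R; rewrite /word_at /mkseq /= addr0 iE.
by rewrite res_succ // iE fS.
Qed.

Lemma walk_rauzy l l' v w : 0 < l -> walk g l v w -> walk g l' w v ->
  clos_trans A E v w.
Proof.
move=> l0 /walkP[f [f0 fl fP]] /walkP[f' [f'0 f'l f'P]].
have hP := walk_glue fP f'P (etrans fl (esym f'0)).
set h := fun i => _ in hP.
have h0 : h 0 = h (l + l').
  rewrite /h leq0n f0; case: leqP => [ll|_]; last by rewrite addKn f'l.
  have l'0 : l' = 0 by lia.
  by rewrite l'0 addn0 fl -f'0 -f'l l'0.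
have hE i : i < l -> E (h i) (h i.+1).
  by move=> il; apply: (loop_rauzy _ h0 hP); lia.
have hl i : i <= l -> h i = f i by rewrite /h => ->.
have C i : i < l -> clos_trans A E (h 0) (h i.+1).
  elim: i => [|i IH] il; first by apply: t_step; apply: hE.
  by apply: t_trans (IH (ltnW il)) (t_step _ _ _ _ (hE _ il)).
by rewrite -f0 -fl -!hl // -[l](prednK l0); apply: C; rewrite prednK.
Qed.

Lemma rauzy_walk v w : clos_trans A E v w -> exists2 l, 0 < l & walk g l v w.
Proof.
elim=> [a b /rauzy_edge ab|a b c _ [l l0 ab] _ [l' _ bc]].
  by exists 1 => //; rewrite walk1.
by exists (l + l'); [lia | exact: walk_cat ab bc].
Qed.

Lemma scc_component S : is_scc E S ->
  [/\ S !=set0, component g S & forall v w, S v -> S w -> (E v w <-> g v w)].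
Proof.
move=> [S0 Sm Smax].
have reach v w : S v -> S w -> exists2 l, 0 < l & walk g l v w.
  by move=> Sv Sw; apply: rauzy_walk; apply: Sm.
split=> //.
  split=> // v x w l l' Sv Sw vx xw.
  have [l1 l10 wv] := reach _ _ Sw Sv.
  have xv := walk_cat xw wv.
  case: (posnP l) vx => [-> /eqP <- //|l0 vx].
  have cvx := walk_rauzy l0 vx xv.
  have cxv : clos_trans A E x v by apply: walk_rauzy xv vx; lia.
  apply: (Smax (S `|` [set x])) => [u||]; [by left| |by right].
  by move=> a b [Sa|->] [Sb|->]; [exact: Sm|exact: t_trans (Sm _ _ Sa Sv) cvx|
    exact: t_trans cxv (Sm _ _ Sv Sb)|exact: t_trans cxv cvx].
move=> v w Sv Sw; split=> [|vw]; first exact: rauzy_edge.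
have [l l0 wv] := reach _ _ Sw Sv; have [f [f0 fl fP]] := walkP wv.
pose h i := if i is i'.+1 then f i' else v.
have hP : is_walk g h l.+1.
  by case=> [_|i il] /=; [rewrite f0 | exact: fP].
have hE : h 0 = h l.+1 by rewrite /= fl.
by have /= := loop_rauzy (ltn0Sn l) hE hP (ltn0Sn l); rewrite f0.
Qed.
End Rauzy.

(** * Closed walks carrying the data *)

Section PeriodicWalks.
Variables (A : finType) (FH : seq (seq A)).
Let g (a b : A) := [:: a; b] \notin FH.

Definition pwalk (M : nat) (f : nat -> A) : Prop :=
  (forall i, g (f i) (f i.+1)) /\ (forall i, f (i + M) = f i).

Definition word_of (M : nat) (f : nat -> A) : seq nat :=
  mkseq (fun i => enc_letter (f i)) M.

Lemma pwalk_mod M f i : pwalk M f -> f (i %% M) = f i.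
Proof.
move=> [_ fM]; rewrite {2}(divn_eq i M) addnC.
by elim: (i %/ M) => [|q IH]; rewrite ?addn0 // mulSn addnCA addnC fM.
Qed.

Lemma pwalk_closed M f : pwalk M f ->
  closed_walk #|A| (rank_words FH) M (word_of M f).
Proof.
move=> fP; rewrite /closed_walk size_mkseq eqxx; apply/allP => i.
rewrite mem_iota => iM; rewrite !nth_mkseq ?ltn_mod //; last by lia.
by rewrite edge_rank (pwalk_mod _ fP); apply: fP.1.
Qed.

Lemma pwalk_of f M : 0 < M -> is_walk g f M -> f 0 = f M ->
  pwalk M (fun i => f (i %% M)).
Proof.
move=> M0 fP f0; split=> i; last by rewrite modnDr.
have iM : i %% M < M by rewrite ltn_mod.
have [E|ne] := eqVneq (i %% M).+1 M.
  have -> : i.+1 %% M = 0 by rewrite -addn1 -modnDml addn1 E modnn.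
  by have := fP _ iM; rewrite E f0.
have -> : i.+1 %% M = (i %% M).+1.
  by rewrite -addn1 -modnDml addn1 modn_small // ltn_neqAle ne.
exact: fP.
Qed.

Lemma pwalk_rot M f t : pwalk M f -> pwalk M (fun i => f (i + t)).
Proof.
by move=> [fg fM]; split=> i; [rewrite addSn | rewrite addnAC].
Qed.

Lemma pwalk_mul m q f : pwalk m f -> pwalk (m * q) f.
Proof.
move=> [fg fM]; split=> // i; elim: q => [|q IH]; first by rewrite muln0 addn0.
by rewrite mulnS addnCA addnC fM.
Qed.

Lemma pwalk_through M d v w : d < M -> walk g d v w -> walk g (M - d) w v ->
  exists f, [/\ pwalk M f, f 0 = v & f d = w].
Proof.
move=> dM /walkP[f [f0 fd fP]] /walkP[f' [f'0 f'd f'P]].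
have := walk_glue fP f'P (etrans fd (esym f'0)); rewrite subnKC ?(ltnW dM) //.
set h := fun i => _ => hP.
have h0 : h 0 = v by rewrite /h.
have hM : h M = v by rewrite /h leqNgt dM.
exists (fun i => h (i %% M)); split.
- by apply: pwalk_of => //; [lia | rewrite h0].
- by rewrite mod0n.
by rewrite modn_small // /h leqnn.
Qed.

(* Two closed walks from the same point that are coupled at step [N]: shrink
   the part where they differ to the largest segment around that step in which
   no step of one can be replaced by a jump to the other. *)
Lemma data_exists L N (al be : nat -> A) :
  0 < N -> N.+1 < L -> is_walk g al L -> is_walk g be L ->
  al 0 = be 0 -> al L = al 0 -> be L = be 0 -> ~~ g (al N) (be N.+1) ->
  exists e al' be', [/\ 0 < e, e.+1 < L, pwalk (L * e) al' /\ pwalk (L * e) be',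
    forall j, e < j -> j < L * e -> al' j = be' j &
    forall j, j < e -> ~~ g (be' j) (al' j.+1) || ~~ g (al' j) (be' j.+1)].
Proof.
move=> N0 NL alP beP ab0 alL beL nab.
pose U i := g (al i) (be i.+1) || g (be i) (al i.+1).
have [i1 /andP[i1N U1] i1max] : exists2 i, (i < N) && U i &
    forall j, (j < N) && U j -> j <= i.
  have ex : exists i, (i < N) && U i.
    by exists 0; rewrite N0 /U ab0 beP //; lia.
  have ub i : (i < N) && U i -> i <= N by case/andP => /ltnW.
  by have [i ? ?] := ex_maxnP ex ub; exists i.
have [i2 /and3P[Ni2 i2L U2] i2min] : exists2 i, [&& N < i, i < L & U i] &
    forall j, [&& N < j, j < L & U j] -> i <= j.
  have ex : exists i, [&& N < i, i < L & U i].
    exists L.-1; have L1 : L.-1 < L by lia.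
    have L0 : 0 < L by lia.
    have aL : g (al L.-1) (al L) by have := alP _ L1; rewrite prednK.
    by rewrite L1 /U (prednK L0) beL -ab0 -alL aL andbT; lia.
  by have [i ? ?] := ex_minnP ex; exists i.
pose c t := if t <= i1 then (if g (al i1) (be i1.+1) then al t else be t)
  else (if g (al i2) (be i2.+1) then be t else al t).
pose mix (f : nat -> A) t := if (i1 < t) && (t <= i2) then f t else c t.
have cL : c L = c 0.
  rewrite /c leq0n [L <= _]leqNgt (_ : i1 < L) /=; last by lia.
  by do 2!case: ifP => _; rewrite ?alL ?beL ?ab0.
have mixP f : f = al \/ f = be -> is_walk g (mix f) L.
  move=> fab i iL; have fi : g (f i) (f i.+1) by case: fab => ->; [apply: alP|apply: beP].
  rewrite /mix; case: (leqP i i1) => h1 /=.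
    have [ii|ii] := eqVneq i i1.
      rewrite ii ltnSn (_ : i1 < i2) /=; last by lia.
      rewrite /c leqnn -ii; rewrite ii in fi *.
      move: U1; rewrite /U; case: ifP => [h _|_ /= h].
        by case: fab => ->; [apply: alP; lia|].
      by case: fab => ->; [|apply: beP; lia].
    rewrite ltnNge (_ : i.+1 <= i1) /=; last by lia.
    rewrite /c h1 (_ : i.+1 <= i1); last by lia.
    by case: ifP => _; [apply: alP|apply: beP].
  have c1 : (i <= i1) = false by lia.
  have c2 : (i.+1 <= i1) = false by lia.
  rewrite (leqW h1) /=; case: (ltngtP i i2) => h2.
  - by [].
  - rewrite /c c1 c2.
    by case: ifP => _; [apply: beP|apply: alP].
  rewrite /c c2; rewrite h2 in fi *; move: U2; rewrite /U; case: ifP => [h _|_ /= h].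
    by case: fab => ->; [|apply: beP].
  by case: fab => ->; [apply: alP|].
have mix0 f : mix f 0 = c 0 by rewrite /mix.
have mixL f : mix f L = c 0 by rewrite /mix [L <= _]leqNgt i2L andbF.
pose e := i2 - i1.+1; have e0 : 0 < e by rewrite /e; lia.
have L0 : 0 < L by lia.
have alW : pwalk L (fun i => mix al (i %% L)).
  by apply: pwalk_of; rewrite ?mix0 ?mixL //; apply: mixP; left.
have M0 : 0 < L * e by rewrite muln_gt0 L0.
pose b t := if t <= L then mix be t else mix al ((t - L) %% L).
have bP : is_walk g b (L * e).
  have -> : L * e = L + L * e.-1 by rewrite -{1}(prednK e0) mulnS.
  apply: (walk_glue (f' := fun i => mix al (i %% L))).
  - by apply: mixP; right.
  - by move=> i _; apply: alW.1.
  by rewrite mod0n mixL mix0.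
have bW : pwalk (L * e) (fun i => b (i %% (L * e))).
  apply: pwalk_of => //; rewrite /b leq0n mix0.
  by case: leqP => h; [have -> : L * e = L by nia|rewrite -{2}[L]muln1 -mulnBr modnMr];
    rewrite ?mixL ?mix0.
have bE t : t < L -> b t = mix be t by move=> tL; rewrite /b ltnW.
have LM t : t <= i2 -> t %% (L * e) = t.
  by move=> ti; rewrite modn_small //; nia.
exists e, (fun j => mix al ((j + i1.+1) %% L)), (fun j => b ((j + i1.+1) %% (L * e))).
split=> //.
- by rewrite /e; lia.
- by split; [exact/pwalk_mul/(pwalk_rot i1.+1 alW) | exact: (pwalk_rot i1.+1 bW)].
- move=> j ej jM.
  have out f t : t <= i1 \/ i2 < t -> mix f t = c t.
    by rewrite /mix => -[h|h]; [rewrite ltnNge h|rewrite [t <= _]leqNgt h andbF].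
  have [jL|Lj] := ltnP (j + i1.+1) (L * e).
    rewrite (modn_small jL) /b; case: leqP => h.
      have hi : i2 < j + i1.+1 by rewrite /e in ej; lia.
      rewrite (out be); last by right.
      have [->|jne] := eqVneq (j + i1.+1) L; first by rewrite modnn mix0 cL.
      by rewrite modn_small ?out //; [right|rewrite ltn_neqAle jne].
    by rewrite -{1}(subnK (ltnW h)) modnDr.
  have -> : (j + i1.+1) %% (L * e) = j + i1.+1 - L * e.
    by rewrite -{1}(subnK Lj) modnDr modn_small //; nia.
  have ti1 : j + i1.+1 - L * e <= i1 by lia.
  have -> : (j + i1.+1) %% L = (j + i1.+1 - L * e) %% L.
    by rewrite -{1}(subnK Lj) -modnDmr modnMr addn0.
  rewrite bE; last by lia.
  by rewrite modn_small; [rewrite !out //; left | lia].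
move=> j je; have ji : j + i1.+1 < i2 by rewrite /e in je; lia.
rewrite addSn !LM ?modn_small; [|lia..].
rewrite !bE; [|lia..].
have inn f t : i1 < t -> t <= i2 -> mix f t = f t by rewrite /mix => -> ->.
rewrite !inn; [|lia..].
set t := j + i1.+1 in ji *; have it : i1 < t by rewrite /t; lia.
have [tN|Nt|->] := ltngtP t N; last by rewrite nab orbT.
  have : ~~ U t by apply/negP => Ut; have := i1max t; rewrite tN Ut => /(_ isT); lia.
  by rewrite /U negb_or => /andP[_ ->].
have : ~~ U t.
  apply/negP => Ut; have := i2min t.
  by rewrite Nt Ut (ltn_trans ji i2L) => /(_ isT); lia.
by rewrite /U negb_or => /andP[_ ->].
Qed.
End PeriodicWalks.

(* Runs of every ordered pair realise the short distances; a periodic stretch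
   followed by runs of every letter realises the long ones. *)
Lemma spread_word m D : 0 < m -> exists w : seq nat,
  all (fun t => t < m) w /\ forall d t t', 0 < d -> d.*2 <= size w + D ->
    t < m -> t' < m ->
    exists p, [/\ p + d < size w, nth 0 w p = t & nth 0 w (p + d) = t'].
Proof.
move=> m0; pose K := m * m + m.
pose w1 := flatten [seq nseq K (q %/ m) ++ nseq K (q %% m) | q <- iota 0 (m * m)].
pose w3 := flatten [seq nseq m q | q <- iota 0 m].
pose U := size w1 + m * m + D + K; pose w2 := mkseq (fun p => p %% m) U.
have sw3 : size w3 = m * m.
  rewrite size_flatten /shape -map_comp -[X in _ = X * _](size_iota 0 m).
  by elim: (iota 0 m) => //= q r ->; rewrite size_nseq mulSn.
exists (w1 ++ w2 ++ w3); split.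
  rewrite !all_cat; apply/and3P; split.
  - apply/allP => t /flatten_mapP[q]; rewrite mem_iota add0n => /andP[_ qm].
    rewrite mem_cat !mem_nseq => /orP[|] /andP[_ /eqP ->]; last by rewrite ltn_mod.
    by rewrite ltn_divLR.
  - by apply/allP => t /mapP[p _ ->]; rewrite ltn_mod.
  apply/allP => t /flatten_mapP[q]; rewrite mem_iota add0n => /andP[_ qm].
  by rewrite mem_nseq => /andP[_ /eqP ->].
move=> d t t' d0; rewrite !size_cat size_mkseq sw3 => dU tm t'm.
have sw1 : size w1 = m * m * (K + K).
  rewrite size_flatten /shape -map_comp -[X in _ = X * _](size_iota 0 (m * m)).
  by elim: (iota 0 (m * m)) => //= q r ->; rewrite size_cat !size_nseq mulSn.
have [dK|Kd] := leqP d K.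
  pose q := t * m + t'; have qm : q < m * m by rewrite /q; nia.
  have nth1 r : r < K + K -> nth 0 w1 (q * (K + K) + r) = if r < K then t else t'.
    move=> rK; rewrite nth_flatten_uniform ?size_map ?size_iota //; last first.
      by apply/allP => u /mapP[x _ ->]; rewrite size_cat !size_nseq.
    rewrite (nth_map 0) ?size_iota // nth_iota // add0n nth_cat size_nseq !nth_nseq.
    rewrite /q divnMDl // divn_small // addn0 modnMDl modn_small //.
    by case: ltnP => // h; rewrite ifT //; lia.
  have q1 r : r < K + K -> q * (K + K) + r < size w1 by rewrite sw1; nia.
  exists (q * (K + K) + K.-1); rewrite -addnA; split.
  - by apply: leq_trans (q1 _ _) (leq_addr _ _); lia.
  - rewrite nth_cat q1 ?nth1; [|lia..].
    by rewrite prednK ?leqnn //; lia.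
  rewrite nth_cat q1 ?nth1; [|lia..].
  by rewrite ifF //; lia.
have {}dU : d <= U by move: dU; rewrite -addnn /U; lia.
pose Y := U + t' * m - d; pose r := (t + (m - Y %% m)) %% m.
have rm : r < m by rewrite ltn_mod.
have Yr : (Y + r) %% m = t.
  have Ym : Y %% m < m by rewrite ltn_mod.
  by rewrite modnDmr -modnDml addnCA subnKC ?(ltnW Ym) // modnDr modn_small.
have t'r : t' * m + r < m * m by nia.
exists (size w1 + (Y + r)).
have pE : size w1 + (Y + r) + d = size w1 + (U + (t' * m + r)) by rewrite /Y; lia.
split; rewrite ?pE.
- by lia.
- rewrite nth_cat ltnNge leq_addr addKn /= nth_cat size_mkseq.
  have YU : Y + r < U by rewrite /Y; rewrite /K in Kd; lia.
  by rewrite YU nth_mkseq.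
rewrite nth_cat ltnNge leq_addr addKn /= nth_cat size_mkseq ltnNge leq_addr addKn /=.
rewrite nth_flatten_uniform ?size_map ?size_iota //; last first.
  by apply/allP => u /mapP[x _ ->]; rewrite size_nseq.
by rewrite (nth_map 0) ?size_iota // nth_iota // add0n nth_nseq rm.
Qed.

(** * Existence of a certificate *)

Section Certificate.
Variables (A : finType) (FH : seq (seq A)).
Hypothesis FH2 : forbids_pairs FH.
Hypothesis notD : ~ condition_D (rauzy (sft1 FH)).
Let g (a b : A) := [:: a; b] \notin FH.
Let E := rauzy (sft1 FH).

Lemma scc_not_reflexive : exists S v, [/\ component g S, S v & ~~ g v v].
Proof.
have [S [sS nS]] : exists S, is_scc E S /\ ~ reflexive_type E S.
  apply: contrapT => H; apply: notD; apply: Or31 => S sS.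
  by apply: contrapT => nr; apply: H; exists S.
have [_ comp gE] := scc_component FH2 sS.
have [v /not_implyP[Sv nvv]] := (existsNP _).2 nS.
by exists S, v; split=> //; apply/negP => /(gE _ _ Sv Sv).
Qed.

Lemma scc_not_symmetric : exists S v w,
  [/\ component g S, S v, S w, g v w & ~~ g w v].
Proof.
have [S [sS nS]] : exists S, is_scc E S /\ ~ symmetric_type E S.
  apply: contrapT => H; apply: notD; apply: Or32 => S sS.
  by apply: contrapT => nr; apply: H; exists S.
have [_ comp gE] := scc_component FH2 sS.
have [v /existsNP[w /not_implyP[Sv /not_implyP[Sw /not_implyP[_ /not_implyP[vw wv]]]]]] :=
  (existsNP _).2 nS.
exists S, v, w; split=> //; first exact/(gE _ _ Sv Sw).
by apply/negP => /(gE _ _ Sw Sv).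
Qed.

Lemma scc_not_state_split N : 0 < N ->
  (forall x a b, N <= x -> walk g (x + N) a b = walk g x a b) ->
  exists S v w, [/\ component g S, S v, S w, walk g N.+1 v w & ~~ g v w].
Proof.
move=> N0 walkN.
have [S [sS nS]] : exists S, is_scc E S /\ ~ state_split_cycle_type E S.
  apply: contrapT => H; apply: notD; apply: Or33 => S sS.
  by apply: contrapT => nr; apply: H; exists S.
have [S0 comp gE] := scc_component FH2 sS.
apply: contrapT => H; apply: nS; apply: (state_split N0 walkN comp) => //.
move=> v w Sv Sw vw; apply: contrapT => /negP nvw; apply: H.
by exists S, v, w.
Qed.

(* The rotations of [gm delta] separate the columns at distance [delta], and those
   of [gm 0], placed along a spreading word, separate the misaligned columns. *)
Lemma header_exists M D (gm : nat -> nat -> A) :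
  0 < M -> (forall delta, pwalk FH M (gm delta)) ->
  (forall delta, delta < M -> delta <> 1 -> ~~ g (gm delta 0) (gm delta delta)) ->
  exists hdr, good_header #|A| (rank_words FH) M (size hdr + D) hdr.
Proof.
move=> M0 gmW gmP.
pose row delta tau := word_of M (fun i => gm delta (i + tau)).
have rowE delta tau i : i < M ->
    nth 0 (row delta tau) i = enc_letter (gm delta ((i + tau) %% M)).
  by move=> iM; rewrite nth_mkseq // (pwalk_mod _ (gmW delta)).
have rowW delta tau : closed_walk #|A| (rank_words FH) M (row delta tau).
  exact/pwalk_closed/pwalk_rot/gmW.
pose z := flatten [seq [seq row delta tau | tau <- iota 0 M] | delta <- iota 0 M].
have zP delta tau : delta < M -> tau < M -> row delta tau \in z.
  move=> dM tM; apply/flatten_mapP; exists delta; first by rewrite mem_iota.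
  by apply: map_f; rewrite mem_iota.
have [w [wM wP]] := spread_word (size z + D) M0.
pose hdr := [seq row 0 tau | tau <- w] ++ z.
exists hdr.
have z0 : 0 < size z.
  by have := zP 0 0 M0 M0; case: (z).
set n := size hdr + _.
have nE : n = size w + (size z + D) by rewrite /n size_cat size_map addnA.
have hn : size hdr <= n by rewrite /n leq_addr.
pose tau i := (M - i) %% M.
have tauM i : tau i < M by rewrite ltn_mod.
have tauK i j : i < M -> (j + tau i) %% M = (j + (M - i)) %% M.
  by move=> iM; rewrite modnDmr.
have tau0 i : i < M -> (i + tau i) %% M = 0.
  by move=> iM; rewrite tauK // subnKC ?modnn // ltnW.
apply/and3P; split; first by rewrite size_cat; lia.
  rewrite all_cat; apply/andP; split; first by apply/allP => u /mapP[t _ ->].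
  by apply/allP => u /flatten_mapP[delta _ /mapP[t _ ->]].
have hdrw p : p < size w -> nth [::] hdr p = row 0 (nth 0 w p).
  by move=> pw; rewrite nth_cat size_map pw (nth_map 0).
have gm0 : ~~ g (gm 0 0) (gm 0 0) by apply: gmP.
apply/allP => dd; rewrite mem_iota => dn; apply/allP => i; rewrite mem_iota => iM.
apply/allP => i'; rewrite mem_iota => i'M; apply/orP.
have [d0|dpos] := posnP dd.
  have [->|ne] := eqVneq i' (i.+1 %% M); [by left | right].
  pose delta := (i' + (M - i)) %% M; have dM : delta < M by rewrite ltn_mod.
  have d1 : delta <> 1.
    move=> d1; case/eqP: ne; rewrite -[LHS](modn_small i'M) -modnDr.
    have -> : i' + M = i' + (M - i) + i by lia.
    by rewrite -modnDml -/delta d1 add1n.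
  have pz := zP delta (tau i) dM (tauM i).
  have ph : row delta (tau i) \in hdr by rewrite mem_cat pz orbT.
  have pl : index (row delta (tau i)) hdr < size hdr by rewrite index_mem.
  apply/hasP; exists (index (row delta (tau i)) hdr); first by rewrite mem_iota.
  rewrite d0 addn0 (modn_small (leq_trans pl hn)) pl /= nth_index // !rowE //.
  by rewrite edge_rank tau0 // tauK // gmP.
right; apply/hasP.
have [d2|d2] := leqP dd.*2 n.
  rewrite nE in d2; have [p [pd wi wi']] := wP _ _ _ dpos d2 (tauM i) (tauM i').
  have pw : p < size w by lia.
  exists p; first by rewrite mem_iota /hdr size_cat size_map; lia.
  have pn : p + dd < n by lia.
  rewrite modn_small // !hdrw // wi wi' !rowE // edge_rank !tau0 // gm0 andbT.
  by rewrite /hdr size_cat size_map; lia.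
have d2' : (n - dd).*2 <= size w + (size z + D) by rewrite -nE; lia.
have dpos' : 0 < n - dd by lia.
have [p [pd wi wi']] := wP _ _ _ dpos' d2' (tauM i') (tauM i).
have pw : p < size w by lia.
exists (p + (n - dd)); first by rewrite mem_iota /hdr size_cat size_map; lia.
have -> : (p + (n - dd) + dd) %% n = p.
  by rewrite -addnA subnK ?modnDr ?modn_small; lia.
rewrite !hdrw // wi wi' !rowE // edge_rank !tau0 // gm0 andbT.
by rewrite /hdr size_cat size_map; lia.
Qed.

Lemma cert_exists tc : exists m e al be hdr,
  good_data #|A| (rank_words FH) m e al be /\
  good_header #|A| (rank_words FH) m (size hdr + m %/ e * tc) hdr.
Proof.
have [N N0 walkN] := walk_periodic g.
have [S1 [v1 [comp1 Sv1 nv1]]] := scc_not_reflexive.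
have [S2 [v2 [w2 [comp2 Sv2 Sw2 vw2 nwv2]]]] := scc_not_symmetric.
have [S3 [a [d [comp3 Sa Sd ad nad]]]] := scc_not_state_split N0 walkN.
pose L := 3 * N; have NL : N.+1 < L by rewrite /L; lia.
have [e [al [be [e0 eL [alW beW] albe coup]]]] : exists e al be, [/\ 0 < e, e.+1 < L,
    pwalk FH (L * e) al /\ pwalk FH (L * e) be,
    forall j, e < j -> j < L * e -> al j = be j &
    forall j, j < e -> ~~ g (be j) (al j.+1) || ~~ g (al j) (be j.+1)].
  have L2 : N + 2 * N = L by rewrite /L; lia.
  have := ad; rewrite -addn1 => /walkD[c [ac]]; rewrite walk1 => cd.
  have /walkP[f1 [f10 f1N f1P]] := walk_refl N0 walkN comp3 Sa.
  have /walkP[f2 [f20 f2N f2P]] := walk_reflM N0 walkN comp3 (isT : 0 < 2) Sa.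
  have /walkP[h1 [h10 h1N h1P]] := ac.
  have da : walk g (2 * N).-1 d a.
    apply: (walk_back N0 walkN comp3) ad _ _ => //; last by lia.
    by apply/dvdnP; exists 3; lia.
  have [h [h0 hN hP]] := walkP da.
  pose h2 i := if i is i'.+1 then h i' else c.
  have h2P : is_walk g h2 (2 * N).
    by case=> [_|i il] /=; [rewrite h0 | apply: hP; lia].
  have alP := walk_glue f1P f2P (etrans f1N (esym f20)).
  have beP := walk_glue h1P h2P h1N.
  rewrite L2 in alP beP.
  have LN : (L <= N) = false by rewrite /L; lia.
  apply: (data_exists N0 NL alP beP); rewrite ?leq0n ?LN ?leqnn ?ltnn.
  - by rewrite f10 h10.
  - by rewrite -L2 addKn f2N f10.
  - rewrite -L2 addKn h10 /h2.
    have -> : 2 * N = (2 * N).-1.+1 by lia.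
    by rewrite hN.
  - by rewrite subSnn f1N /= h0.
pose M := L * e; have NM : N %| M by rewrite /M /L -mulnA dvdn_mull // dvdn_mulr.
have M3 : 3 * N <= M by rewrite /M leq_pmulr.
have M0 : 0 < M by lia.
have gam delta : exists f, pwalk FH M f /\
    (delta < M -> delta <> 1 -> ~~ g (f 0) (f delta)).
  have [dM|Md] : delta < M \/ M <= delta by [lia]; last by exists al; split=> //; lia.
  have thr v w : walk g delta v w -> walk g (M - delta) w v -> ~~ g v w ->
      exists f, pwalk FH M f /\ (delta < M -> delta <> 1 -> ~~ g (f 0) (f delta)).
    move=> vw wv nvw; have [f [fW f0 fd]] := pwalk_through dM vw wv.
    by exists f; split=> // _ _; rewrite f0 fd.
  have [d1|d1] := eqVneq delta 1; first by exists al; split=> // _ /(_ d1).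
  have [d0|d0] := posnP delta.
    apply: (thr v1 v1) => //; first by rewrite d0 /=.
    rewrite d0 subn0; case/dvdnP: NM => q ME.
    rewrite ME; apply: (walk_reflM N0 walkN comp1) => //.
    by move: M0; rewrite ME muln_gt0 => /andP[].
  have [dM1|dM1] := eqVneq delta M.-1.
    apply: (thr w2 v2) => //; last first.
      by rewrite dM1 (_ : M - M.-1 = 1) ?walk1 //; lia.
    rewrite dM1; apply: (walk_back N0 walkN comp2 (x := 1)); rewrite ?walk1 //.
      by rewrite add1n prednK.
    by lia.
  apply: contrapT => H; move/negP: (nad); apply.
  have H' v w : S3 v -> S3 w -> walk g delta v w -> walk g (M - delta) w v -> g v w.
    by move=> Sv Sw vw wv; apply: contrapT => /negP nvw; apply: H; apply: (thr v w).
  have [dN|Nd] := leqP N (M - delta).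
    apply: (step_power N0 walkN comp3 (d := delta)) => //; first by lia.
    move=> v w Sv Sw vw; apply: H' => //.
    by apply: (walk_back N0 walkN comp3) vw _ _ => //; rewrite subnKC // ltnW.
  apply: (step_power_rev N0 walkN comp3 (d := M - delta)) => //; first by lia.
  move=> v w Sv Sw wv; apply: H' => //.
  by apply: (walk_back N0 walkN comp3) wv _ _ => //; [rewrite subnK // ltnW|lia].
have [gm gmP] := choice gam.
have [hdr hdrP] := header_exists (M %/ e * tc) M0 (fun delta => (gmP delta).1)
  (fun delta => (gmP delta).2).
exists M, e, (word_of M al), (word_of M be), hdr; split=> //.
have eM : e.+1 < M by rewrite /M; nia.
apply/and5P; split=> //; first by rewrite /M mulnK.
  exact: pwalk_closed.
  apply/and3P; split; first exact: pwalk_closed.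
    apply/allP => j; rewrite mem_iota => jM; case: leqP => //= ej.
    by rewrite !nth_mkseq // albe.
  apply/allP => j; rewrite mem_iota => je.
  by rewrite !nth_mkseq ?edge_rank; [apply: coup|lia..].
Qed.
End Certificate.

Lemma enc_wordsE (A : finType) (F : seq (seq A)) :
  enc_words F = code_of (rank_words F).
Proof.
rewrite /enc_words /enc_seq /code_of /codable_seq -map_comp; congr CodeSeq.code.
by apply: eq_map => w /=; rewrite /code_of -map_comp; congr CodeSeq.code; apply: eq_map.
Qed.

Lemma enc_patternsE (B : finType) (F : seq (pattern2 B)) :
  enc_patterns F = code_of (pattern_codes F).
Proof.
rewrite /enc_patterns /enc_seq /code_of /codable_seq -map_comp; congr CodeSeq.code.
by apply: eq_map => p /=; rewrite /code_of -map_comp; congr CodeSeq.code; apply: eq_map.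
Qed.

Lemma unrank_wordsK (A : finType) (a0 : A) (F : seq (seq nat)) :
  all (all (fun i => i < #|A|)) F -> rank_words (unrank_words a0 F) = F.
Proof.
move=> Fk; rewrite /rank_words /unrank_words -map_comp -[RHS]map_id.
apply/eq_in_map => w wF /=; rewrite -map_comp -[RHS]map_id.
by apply/eq_in_map => i iw /=; rewrite enc_letter_nth ?(allP (allP Fk _ wF)).
Qed.

Lemma roots_computable : exists algo : murec 4,
  forall (A : finType) (FH : seq (seq A)),
  forbids_pairs FH -> ~ condition_D (rauzy (sft1 FH)) ->
  forall (B : finType) (FY : seq (pattern2 B)),
  exists (m n : nat) (FV : seq (seq A)),
    [/\ (0 < m)%N, (0 < n)%N,
        is_root m n (combined (sft1 FH) (sft1 FV)) (sft2 FY) &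
        computes algo (enc_input FH FY) (enc_output m n FV)].
Proof.
have [algo algoP] := algo_search; exists algo => A FH FH2 nD B FY.
pose x : input := (#|A|, #|B|, rank_words FH, pattern_codes FY).
have [m [e [al [be [hdr [dat hd]]]]]] :=
  cert_exists FH2 nD (size (tiles #|B| (pattern_codes FY))).
pose c := [:: [:: m; e], al, be & hdr].
have cx : good_cert x c by rewrite /good_cert /cert_n /cert_hdr /= drop0 dat.
have vx : input_code (enc_input FH FY) = code_of x.
  by rewrite /input_code /= enc_wordsE enc_patternsE.
have [c' /andP[dat' hd'] cc'] := algoP _ _ _ vx cx.
have a0 : A.
  have m0 := m_gt0 dat' hd'; have /and3P[+ _ _] := walk_al dat' m0.
  by move=> lt; apply: enum_val (Ordinal lt).
exists (cert_m c'), (cert_n x c'), (unrank_words a0 (cert_forbidden x c')).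
split.
- exact: m_gt0 dat' hd'.
- exact: height_gt0 hd'.
- exact: is_root_combined dat' hd'.
move: cc'; rewrite /enc_output enc_wordsE unrank_wordsK; last first.
  by apply/allP => w; rewrite mem_filter mem_words => /and3P[].
by [].
Qed.

Theorem theorem4p1 :
  (forall (A : finType) (H : set (config1 A)),
     nearest_neighbor H -> ~ condition_D (rauzy H) ->
     forall (B : finType) (Y : set (config2 B)), is_sft2 Y ->
     exists V : set (config1 A), is_sft1 V /\
       exists m n : nat,
         [/\ (0 < m)%N, (0 < n)%N & is_root m n (combined H V) Y])
  /\
  (exists algo : murec 4,
     forall (A : finType) (FH : seq (seq A)),
     forbids_pairs FH -> ~ condition_D (rauzy (sft1 FH)) ->
     forall (B : finType) (FY : seq (pattern2 B)),
     exists (m n : nat) (FV : seq (seq A)),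
       [/\ (0 < m)%N, (0 < n)%N,
           is_root m n (combined (sft1 FH) (sft1 FV)) (sft2 FY) &
           computes algo (enc_input FH FY) (enc_output m n FV)]).
Proof.
split; last exact: roots_computable.
move=> A _ [FH FH2 ->] nD B _ [FY ->].
have [algo algoP] := roots_computable.
have [m [n [FV [m0 n0 root _]]]] := algoP A FH FH2 nD B FY.
by exists (sft1 FV); split; [exists FV | exists m, n].
Qed.
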